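(* Let $n'_2 = 17\cdot 2^{2}-2 = 66$. The coinvariant space $\mathbb Z/2 \otimes_{GL_4} {\rm Ann}_{\overline{\mathcal A}}[P_{n'_2}^{\otimes 4}]^{*}$ is the $\mathbb Z/2$-vector space of dimension $1$ with the basis $\{[x_1^{(1)}x_2^{(1)}x_3^{(1)}x_4^{(63)}]\}$.
   Context: $\mathcal A$ is the mod 2 Steenrod algebra and $\overline{\mathcal A}$ its set of positive-degree elements. For $h\ge 1$, $P^{\otimes h}=\mathbb Z/2[t_1,\ldots,t_h]$ with $\deg t_i=1$, regarded as the unstable $\mathcal A$-algebra $H^*((\mathbb RP^\infty)^{h};\mathbb Z/2)$; $P^{\otimes h}_n$ is its degree $n$ part. $GL_h=GL_h(\mathbb Z/2)$ acts on $P^{\otimes h}$ by linear substitutions of variables, commuting with $\mathcal A$. The linear dual $[P^{\otimes h}_n]^{*}=H_n((\mathbb RP^\infty)^h;\mathbb Z/2)$ carries the dual $GL_h$-action and the dual right action of $\mathcal A$; $x_1^{(a_1)}\cdots x_h^{(a_h)}$ denotes the basis element dual to the monomial $t_1^{a_1}\cdots t_h^{a_h}$. ${\rm Ann}_{\overline{\mathcal A}}[P_n^{\otimes h}]^{*}$ is the subspace of elements of $[P^{\otimes h}_n]^{*}$ annihilated by all positive-degree Steenrod operations; it is a $GL_h$-submodule, and $\mathbb Z/2\otimes_{GL_h}{\rm Ann}_{\overline{\mathcal A}}[P_n^{\otimes h}]^{*}$ is its space of $GL_h$-coinvariants. For $\zeta\in {\rm Ann}_{\overline{\mathcal A}}[P_n^{\otimes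 h}]^{*}$, $[\zeta]$ is its image in the coinvariants. *)

(* Defs.v *)
From HB Require Import structures.
From mathcomp Require Import all_boot all_order all_algebra all_fingroup.
From mathcomp Require Import generic_quotient ring_quotient finmap.
From mathcomp.multinomials Require Import monalg mpoly.
From mathcomp Require Import zify.

Set Implicit Arguments.
Unset Strict Implicit.
Unset Printing Implicit Defensive.

Import GRing.Theory.
Local Open Scope ring_scope.
Local Open Scope quotient_scope.

(* [monalg] binds the same notation to another type, in the same scope. *)
Notation "{ 'mpoly' T [ n ] }" := (mpoly n T) : type_scope.

(** * Quotient of a finite-dimensional vector space by a subspace *)

Section VQuot.
Variables (F : fieldType) (vT : vectType F) (U : {vspace vT}).

Let I : zmodClosed vT := [the zmodClosed vT of pred_of_vspace U].

Definition vquot := Quotient.quot I.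

HB.instance Definition _ := GRing.Zmodule.on vquot.
HB.instance Definition _ := EqQuotient.on vquot.
HB.instance Definition _ := ZmodQuotient.on vquot.

Definition vquot_pi (v : vT) : vquot := \pi_vquot v.

Lemma vquot_piP u v : reflect (vquot_pi u = vquot_pi v) (u - v \in U).
Proof.
by rewrite -[_ \in _]/(u - v \in I) Quotient.idealrBE; apply: eqP.
Qed.

Definition vquot_scale (c : F) (q : vquot) : vquot := vquot_pi (c *: repr q).

Lemma vquot_repr q : vquot_pi (repr q) = q.
Proof. exact: reprK. Qed.

Lemma vquot_piD u v : vquot_pi (u + v) = vquot_pi u + vquot_pi v.
Proof. by rewrite /vquot_pi piE. Qed.

Lemma vquot_piZ c v : vquot_pi (c *: v) = vquot_scale c (vquot_pi v).
Proof.
apply/vquot_piP; rewrite -scalerBr memvZ //.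
by apply/vquot_piP; rewrite vquot_repr.
Qed.

Fact vquot_scaleA a b q : vquot_scale a (vquot_scale b q) = vquot_scale (a * b) q.
Proof. by rewrite -[q]vquot_repr -!vquot_piZ scalerA. Qed.

Fact vquot_scale1 : left_id 1 vquot_scale.
Proof. by move=> q; rewrite -[q]vquot_repr -!vquot_piZ scale1r. Qed.

Fact vquot_scaleDr : right_distributive vquot_scale +%R.
Proof.
move=> c p q; rewrite -[q]vquot_repr -[p]vquot_repr -vquot_piD -!vquot_piZ.
by rewrite scalerDr vquot_piD.
Qed.

Fact vquot_scaleDl q : {morph vquot_scale^~ q : a b / a + b}.
Proof.
by move=> a b; rewrite -[q]vquot_repr -!vquot_piZ scalerDl vquot_piD.
Qed.

HB.instance Definition _ := GRing.Zmodule_isLmodule.Build F vquot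
  vquot_scaleA vquot_scale1 vquot_scaleDr vquot_scaleDl.

Fact vquot_pi_is_linear : linear vquot_pi.
Proof. by move=> c u v; rewrite vquot_piD vquot_piZ. Qed.

HB.instance Definition _ :=
  GRing.isLinear.Build F vT vquot _ vquot_pi vquot_pi_is_linear.

Fact vquot_vect_iso : Vector.axiom (\dim U^C) vquot.
Proof.
pose f (q : vquot) := vsproj U^C (repr q - projv U (repr q)).
have fpi v : f (vquot_pi v) = vsproj U^C (v - projv U v).
  rewrite /f; congr (vsproj _ _); set u := repr _.
  have uvU : u - v \in U by apply/vquot_piP; rewrite vquot_repr.
  rewrite -[u](subrK v) linearD /= (projv_id uvU).
  by rewrite opprD addrACA subrr add0r.
have fL : linear f.
  move=> c p q; rewrite -[p]vquot_repr -[q]vquot_repr -linearP !fpi -linearP.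
  by congr (vsproj _ _); rewrite scalerBr (linearP (projv U)) opprD addrACA.
have fK : cancel f (fun w => vquot_pi (vsval w)).
  move=> q; rewrite -[q]vquot_repr fpi vsprojK ?memv_projC //.
  by apply/vquot_piP; rewrite addrAC subrr add0r memvN memv_proj.
have Kf : cancel (fun w => vquot_pi (vsval w)) f.
  move=> w; rewrite fpi; have /eqP -> : projv U (vsval w) == 0.
    by rewrite -memv_ker lker_proj subvsP.
  by rewrite subr0 vsvalK.
have [h hL h_bij] := subvs_vect_iso U^C.
exists (h \o f); first by move=> c p q /=; rewrite fL hL.
by apply: bij_comp => //; exists (fun w => vquot_pi (vsval w)).
Qed.

HB.instance Definition _ := Lmodule_hasFinDim.Build F vquot vquot_vect_iso.

Lemma dim_vquot : \dim {: vquot} = (\dim {: vT} - \dim U)%N.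
Proof. by rewrite dimvf /dim /= dimv_compl. Qed.

End VQuot.

Notation F2 := 'F_2.

(** * Steenrod squares on F_2[t_1, ..., t_n] *)

Section Steenrod.
Variable n : nat.
Implicit Types (p q : {mpoly F2[n]}) (k d e : nat).

(** The total square is the ring endomorphism with t_i |-> t_i + t_i^2; the
    operation [Sq k] is its component raising degrees by [k]. *)
Definition total_Sq p : {mpoly F2[n]} := p \mPo [tuple 'X_i + 'X_i ^+ 2 | i < n].

Definition Sq k p : {mpoly F2[n]} :=
  \sum_(d < msize p) pihomog mdeg (d + k) (total_Sq (pihomog mdeg d p)).

HB.instance Definition _ := GRing.Linear.copy total_Sq
  (fun p => p \mPo [tuple 'X_i + 'X_i ^+ 2 | i < n]).
HB.instance Definition _ := GRing.RMorphism.copy total_Sq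
  (fun p => p \mPo [tuple 'X_i + 'X_i ^+ 2 | i < n]).

Lemma Sq_widen N k p : (msize p <= N)%N ->
  Sq k p = \sum_(d < N) pihomog mdeg (d + k) (total_Sq (pihomog mdeg d p)).
Proof.
move=> le_pN; rewrite /Sq (big_ord_widen N (fun d =>
  pihomog mdeg (d + k) (total_Sq (pihomog mdeg d p)))) //.
rewrite big_mkcond /=; apply: eq_bigr => d _; case: ltnP => // le_pd.
suff -> : pihomog mdeg d p = 0 by rewrite !linear0.
rewrite pihomogE big_seq_cond big1 // => a /andP[/msize_mdeg_lt + /eqP da].
by rewrite da ltnNge le_pd.
Qed.

Fact Sq_is_linear k : linear (Sq k).
Proof.
move=> c p q; pose N := maxn (msize (c *: p + q)) (maxn (msize p) (msize q)).
rewrite !(@Sq_widen N) ?leq_max ?leqnn ?orbT //.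
by rewrite scaler_sumr -big_split; apply: eq_bigr => d _; rewrite !linearP.
Qed.

HB.instance Definition _ k :=
  GRing.isLinear.Build F2 {mpoly F2[n]} {mpoly F2[n]} _ (Sq k) (Sq_is_linear k).

Lemma Sq_dhomogE k d p : p \is d.-homog ->
  Sq k p = pihomog mdeg (d + k) (total_Sq p).
Proof.
move=> hp; rewrite (@Sq_widen (maxn (msize p) d.+1)) ?leq_maxl //.
have ltd : (d < maxn (msize p) d.+1)%N by rewrite leq_max leqnn orbT.
rewrite (bigD1 (Ordinal ltd)) //= (pihomog_dE hp) big1 ?addr0 // => e.
rewrite -val_eqE /= eq_sym => ne; rewrite (pihomog_ne0 ne) // !linear0 //.
Qed.

Lemma Sq_dhomog k d p : p \is d.-homog -> Sq k p \is (d + k).-homog.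
Proof. by move=> hp; rewrite (Sq_dhomogE _ hp) pihomogP. Qed.

Lemma pihomogM e p q :
  pihomog mdeg e (p * q) =
  \sum_(i < e.+1) pihomog mdeg i p * pihomog mdeg (e - i) q.
Proof.
pose f p q := \sum_(i < e.+1) pihomog mdeg i p * pihomog mdeg (e - i) q.
have fDl q' : {morph f^~ q' : p q / p + q}.
  move=> p1 p2; rewrite /f -big_split; apply: eq_bigr => i _.
  by rewrite linearD mulrDl.
have fDr p' : {morph f p' : p q / p + q}.
  move=> p1 p2; rewrite /f -big_split; apply: eq_bigr => i _.
  by rewrite linearD mulrDr.
have fZl c q' p' : f (c *: p') q' = c *: f p' q'.
  by rewrite /f scaler_sumr; apply: eq_bigr => i _; rewrite linearZ scalerAl.
have fZr c q' p' : f p' (c *: q') = c *: f p' q'.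
  by rewrite /f scaler_sumr; apply: eq_bigr => i _; rewrite linearZ scalerAr.
have f0l q' : f 0 q' = 0 by rewrite /f big1 // => i _; rewrite linear0 mul0r.
have f0r p' : f p' 0 = 0 by rewrite /f big1 // => i _; rewrite linear0 mulr0.
rewrite -/(f p q); elim/mpolyind: p => [|c a p _ _ IHp].
  by rewrite mul0r linear0 f0l.
rewrite mulrDl linearD /= {}IHp fDl; congr (_ + _).
rewrite -scalerAl linearZ /= fZl; congr (_ *: _).
elim/mpolyind: q => [|c' b q _ _ IHq]; first by rewrite mulr0 linear0 f0r.
rewrite mulrDr linearD /= IHq fDr; congr (_ + _).
rewrite -scalerAr linearZ /= fZr; congr (_ *: _).
rewrite -mpolyXD pihomogX /f /= mdegD.
have [le_ae|lt_ea] := leqP (mdeg a) e.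
  have lta : (mdeg a < e.+1)%N by [].
  rewrite (bigD1 (Ordinal lta)) //= big1 => [|i]; last first.
    by rewrite -val_eqE /= eq_sym pihomogX => /negPf->; rewrite mul0r.
  rewrite !pihomogX eqxx addr0 -{1}(subnKC le_ae) eqn_add2l.
  by case: ifP; rewrite ?mulr0 // mpolyXD.
rewrite gtn_eqF ?(leq_trans lt_ea) ?leq_addr // big1 // => i _.
by rewrite pihomogX gtn_eqF ?mul0r // (leq_trans _ lt_ea).
Qed.

Fact total_SqX i : total_Sq 'X_i = 'X_i + 'X_i ^+ 2.
Proof. by rewrite /total_Sq comp_mpolyXU -tnth_nth tnth_mktuple. Qed.

Fact total_Sq_monomial a :
  [/\ pihomog mdeg (mdeg a) (total_Sq 'X_[a]) = 'X_[a],
      pihomog mdeg (mdeg a + mdeg a) (total_Sq 'X_[a]) = 'X_[a] ^+ 2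
    & forall e, ~~ (mdeg a <= e <= mdeg a + mdeg a)%N ->
                pihomog mdeg e (total_Sq 'X_[a]) = 0].
Proof.
pose Q (d : nat) p := [/\ pihomog mdeg d (total_Sq p) = p,
  pihomog mdeg (d + d) (total_Sq p) = p ^+ 2
  & forall e, ~~ (d <= e <= d + d)%N -> pihomog mdeg e (total_Sq p) = 0].
suff : Q (mdeg a) 'X_[a] by [].
have Q1 : Q 0 1.
  have h1 : (1 : {mpoly F2[n]}) \is 0.-homog by apply: dhomog1.
  rewrite /Q rmorph1 expr1n addn0 pihomog_dE //; split=> // e he.
  by apply: (pihomog_ne0 _ h1); lia.
have QM d e p q : Q d p -> Q e q -> Q (d + e)%N (p * q).
  case=> p1 p2 p0 [q1 q2 q0]; rewrite /Q rmorphM.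
  have key s t : (forall i, (i <= s + t)%N -> i != s ->
       ~~ (d <= i <= d + d)%N || ~~ (e <= s + t - i <= e + e)%N) ->
     pihomog mdeg (s + t) (total_Sq p * total_Sq q) =
     pihomog mdeg s (total_Sq p) * pihomog mdeg t (total_Sq q).
    move=> hst; have lts : (s < (s + t).+1)%N by rewrite ltnS leq_addr.
    rewrite pihomogM (bigD1 (Ordinal lts)) //= addKn big1 ?addr0 // => i.
    rewrite -val_eqE /= => ne; have /orP[] := hst i (ltn_ord i) ne.
      by move=> /p0->; rewrite mul0r.
    by move=> /q0->; rewrite mulr0.
  split.
  - rewrite key ?p1 ?q1 // => i le_i ne; rewrite -negb_and; apply: contra ne.
    by lia.
  - rewrite addnACA key ?p2 ?q2 ?exprMn // => i le_i ne.
    by rewrite -negb_and; apply: contra ne; lia.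
  - move=> c hc; rewrite pihomogM big1 // => i _.
    have /orP[] : ~~ (d <= i <= d + d)%N || ~~ (e <= c - i <= e + e)%N.
      by rewrite -negb_and; apply: contra hc; have := ltn_ord i; lia.
    + by move=> /p0->; rewrite mul0r.
    + by move=> /q0->; rewrite mulr0.
have QX i : Q 1%N 'X_i.
  have hX : ('X_i : {mpoly F2[n]}) \is 1.-homog by rewrite dhomogX /= mdeg1.
  have hX2 : ('X_i ^+ 2 : {mpoly F2[n]}) \is 2.-homog.
    by rewrite expr2; apply: (dhomogM hX hX).
  rewrite /Q total_SqX; split.
  - by rewrite linearD /= (pihomog_dE hX) (@pihomog_ne0 _ _ mdeg 2 1) ?addr0.
  - by rewrite linearD /= (pihomog_dE hX2) (@pihomog_ne0 _ _ mdeg 1 2) ?add0r.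
  move=> e he; rewrite linearD /= (@pihomog_ne0 _ _ mdeg 1 e) //.
    by rewrite (@pihomog_ne0 _ _ mdeg 2 e) ?addr0 //; apply: contraNneq he => <-.
  by apply: contraNneq he => <-.
have QXn d p k : Q d p -> Q (d * k)%N (p ^+ k).
  move=> Qp; elim: k => [|k IHk]; first by rewrite muln0.
  by rewrite mulnS exprS; apply: QM.
rewrite mdegE mpolyXE_id; elim/big_rec2: _ => // i d p _ IH.
by apply: QM => //; rewrite -[X in Q X _]mul1n; apply: QXn.
Qed.

Fact F2_idem (c : F2) : c ^+ 2 = c.
Proof. by case: c => [[|[|[]]]] // i; apply: val_inj. Qed.

Fact mpolyF2_pchar2 : 2 \in [pchar {mpoly F2[n]}].
Proof. by rewrite (rmorph_pchar (@mpolyC n F2)) // pchar_Fp. Qed.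

Lemma sqrrD_F2 p q : (p + q) ^+ 2 = p ^+ 2 + q ^+ 2.
Proof. exact: (pFrobenius_autD_comm mpolyF2_pchar2 (mulrC p q)). Qed.

(** [Sq] satisfies the properties characterizing the unstable action. *)

Lemma Sq0 p : Sq 0 p = p.
Proof.
elim/mpolyind: p => [|c a p _ _ IHp]; first by rewrite linear0.
rewrite linearP /= IHp (@Sq_dhomogE _ (mdeg a)) ?dhomogX ?eqxx // addn0.
by have [-> _ _] := total_Sq_monomial a.
Qed.

Lemma dhomog_ind d (P : {mpoly F2[n]} -> Prop) :
  P 0 -> (forall c a q, mdeg a = d -> P q -> P (c *: 'X_[a] + q)) ->
  forall p, p \is d.-homog -> P p.
Proof.
move=> P0 PS p /dhomogP hp; rewrite [p]mpolyE.
move: hp; elim: (msupp p) => [|a s IHs] hs; first by rewrite big_nil.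
rewrite big_cons; apply: PS; first by apply: hs; rewrite mem_head.
by apply: IHs => b bs; apply: hs; rewrite inE bs orbT.
Qed.

Lemma Sq_top d p : p \is d.-homog -> Sq d p = p ^+ 2.
Proof.
move: p; apply: (@dhomog_ind d (fun p => Sq d p = p ^+ 2)).
  by rewrite linear0 expr0n.
move=> c a q <- IHq; rewrite linearP /= IHq.
rewrite (@Sq_dhomogE _ (mdeg a)) ?dhomogX //=.
have [_ -> _] := total_Sq_monomial a.
by rewrite sqrrD_F2 exprZn F2_idem.
Qed.

Lemma Sq_unstable k d p : p \is d.-homog -> (d < k)%N -> Sq k p = 0.
Proof.
move=> hp dk; move: p hp; apply: (@dhomog_ind d (fun p => Sq k p = 0)).
  by rewrite linear0.
move=> c a q da IHq; rewrite linearP /= IHq; rewrite -da in dk.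
rewrite (@Sq_dhomogE _ (mdeg a)) ?dhomogX //=.
have [_ _ ->] := total_Sq_monomial a; first by rewrite scaler0 addr0.
by rewrite leq_add2l [(k <= _)%N]leqNgt dk andbF.
Qed.

Lemma Sq_cartan k p q : Sq k (p * q) = \sum_(i < k.+1) Sq i p * Sq (k - i) q.
Proof.
elim/mpolyind: p q => [q|c a p _ _ IHp q].
  by rewrite mul0r linear0 big1 // => i _; rewrite linear0 mul0r.
rewrite mulrDl linearD /= {}IHp.
under [RHS]eq_bigr do rewrite linearD mulrDl /=.
rewrite big_split /=; congr (_ + _).
under [RHS]eq_bigr do rewrite linearZ -scalerAl /=.
rewrite -scaler_sumr -scalerAl linearZ /=; congr (_ *: _).
elim/mpolyind: q => [|c' b q _ _ IHq].
  by rewrite mulr0 linear0 big1 // => i _; rewrite linear0 mulr0.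
rewrite mulrDr linearD /= {}IHq.
under [RHS]eq_bigr do rewrite linearD mulrDr /=.
rewrite big_split /=; congr (_ + _).
under [RHS]eq_bigr do rewrite linearZ -scalerAr /=.
rewrite -scaler_sumr -scalerAr linearZ /=; congr (_ *: _).
rewrite -mpolyXD (@Sq_dhomogE _ (mdeg a + mdeg b)) ?dhomogX /= ?mdegD //.
rewrite mpolyXD rmorphM pihomogM.
have [_ _ a0] := total_Sq_monomial a; have [_ _ b0] := total_Sq_monomial b.
rewrite -(big_mkord xpredT (fun i => pihomog mdeg i (total_Sq 'X_[a]) *
  pihomog mdeg (mdeg a + mdeg b + k - i) (total_Sq 'X_[b]))).
rewrite (@big_cat_nat _ _ _ (mdeg a)) //=; last by lia.
rewrite (@big_cat_nat _ _ _ (mdeg a + k.+1) (mdeg a)) //=; [|lia|lia].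
rewrite big_nat big1 ?add0r => [|i]; last first.
  by move=> hi; rewrite a0 ?mul0r //; lia.
rewrite addrC big_nat big1 ?add0r => [|i]; last first.
  by move=> hi; rewrite b0 ?mulr0 //; lia.
rewrite -[X in \sum_(X <= _ < _) _]add0n big_addn addKn big_mkord.
apply: eq_bigr => i _; rewrite (@Sq_dhomogE _ (mdeg a)) ?dhomogX //=.
rewrite (@Sq_dhomogE _ (mdeg b)) ?dhomogX //= [(i + _)%N]addnC.
by congr (_ * pihomog _ _ _); have := ltn_ord i; lia.
Qed.

End Steenrod.

(** * The Steenrod algebra and its action *)

(** The free associative F_2-algebra on symbols Sq^0, Sq^1, Sq^2, ...; the
    generator Sq^k is [<< fmu k >>].  The Steenrod algebra is its quotient by
    Sq^0 = 1 and the Adem relations, all of which act trivially on polynomials.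
    An operation of degree k is thus the class of an element of the free algebra
    all of whose words have total degree k, and acts as any such
    representative does. *)
Definition free_steenrod := {malg F2[{fmonom nat}]}.

Definition steenrod_homog (k : nat) (theta : free_steenrod) : bool :=
  all (fun w : {fmonom nat} => sumn w == k) (monalg.msupp theta).

Definition steenrod_act n (theta : free_steenrod) (p : {mpoly F2[n]}) :
    {mpoly F2[n]} :=
  \sum_(w <- monalg.msupp theta)
     monalg.mcoeff w theta *: foldr (@Sq n) p (w : {fmonom nat}).

Section SteenrodAct.
Variable n : nat.
Implicit Types (p q : {mpoly F2[n]}) (w : seq nat) (theta : free_steenrod).

Fact Sqs_is_linear w : linear (fun p => foldr (@Sq n) p w).
Proof. by move=> c p q; elim: w => //= k w ->; rewrite linearP. Qed.

Fact steenrod_act_is_linear theta : linear (steenrod_act (n := n) theta).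
Proof.
move=> c p q; rewrite /steenrod_act scaler_sumr -big_split /=.
apply: eq_bigr => w _; rewrite Sqs_is_linear scalerDr !scalerA.
by rewrite [X in X *: _]mulrC.
Qed.

HB.instance Definition _ theta :=
  GRing.isLinear.Build F2 {mpoly F2[n]} {mpoly F2[n]} _
    (steenrod_act (n := n) theta) (steenrod_act_is_linear theta).

Lemma Sqs_dhomog w d p : p \is d.-homog ->
  foldr (@Sq n) p w \is (d + sumn w).-homog.
Proof.
move=> hp; elim: w => [|k w IHw] /=; first by rewrite addn0.
by rewrite addnCA addnC; apply: Sq_dhomog.
Qed.

Lemma steenrod_act_dhomog k theta d p : steenrod_homog k theta ->
  p \is d.-homog -> steenrod_act theta p \is (d + k).-homog.
Proof.
move=> /allP htheta hp; rewrite /steenrod_act big_seq.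
apply: rpred_sum => w /htheta /eqP <-.
by apply: rpredZ; apply: Sqs_dhomog.
Qed.

Lemma steenrod_act_Sq k p : steenrod_act << fmu k >> p = Sq k p.
Proof.
rewrite /steenrod_act monalg.msuppU oner_eq0 big_seq_fset1.
by rewrite monalg.mcoeffUU scale1r fmuE.
Qed.

Lemma steenrod_homog_Sq k : steenrod_homog k << fmu k >>.
Proof.
rewrite /steenrod_homog monalg.msuppU oner_eq0.
by apply/allP => w; rewrite inE => /eqP->; rewrite fmuE /= addn0.
Qed.

End SteenrodAct.

(** * Homology, the annihilator and its coinvariants

    The parameter [m] is one less than the number [h] of variables: [dhomog]
    carries a vector space structure only for a successor number of variables. *)

Section Homology.
Variable m : nat.
Local Notation h := m.+1.

(** [dhomog h F2 n] is the degree n part of the polynomial ring. *)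
Definition homology n := 'Hom(dhomog h F2 n, F2^o).

HB.instance Definition _ n := Vector.on (homology n).

Definition homog_part n (p : {mpoly F2[h]}) : dhomog h F2 n :=
  DHomog (pihomogP mdeg n p).

Fact homog_part_is_linear n : linear (homog_part n).
Proof. by move=> c p q; apply: val_inj; rewrite /= linearP. Qed.

HB.instance Definition _ n :=
  GRing.isLinear.Build F2 {mpoly F2[h]} (dhomog h F2 n) _ (homog_part n)
    (homog_part_is_linear n).

Lemma homog_part_id n (p : dhomog h F2 n) : homog_part n (val p) = p.
Proof. by apply: val_inj; apply: pihomog_dE; apply: dhomog_is_dhomog. Qed.

(** The element x_1^(a_1) ... x_h^(a_h) dual to the monomial t^a. *)
Definition dual_monomial n (a : 'X_{1..h}) : homology n :=
  linfun (fun p : dhomog h F2 n => (val p)@_a : F2^o).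

(** Right action on homology: (f theta)(p) = f (theta p).  When theta has
    degree k and d + k = n, theta p lies in degree n already. *)
Definition steenrod_dual n (f : homology n) (theta : free_steenrod) d :
    homology d :=
  linfun (fun p : dhomog h F2 d => f (homog_part n (steenrod_act theta (val p)))).

(** Operations of degree k > n kill f for degree reasons, so only the case
    k <= n is listed. *)
Definition annihilated n (f : homology n) : Prop :=
  forall d k (theta : free_steenrod), (d + k = n)%N -> (0 < k)%N ->
    steenrod_homog k theta -> steenrod_dual f theta d = 0.

Fact dual_monomialE n a (p : dhomog h F2 n) : dual_monomial n a p = (val p)@_a.
Proof.
have L : linear (fun p : dhomog h F2 n => (val p)@_a : F2^o).
  by move=> c p' q; rewrite /= mcoeffD mcoeffZ.
pose L' := GRing.isLinear.Build _ _ _ _ _ L.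
pose g : {linear dhomog h F2 n -> F2^o} := HB.pack (fun p : dhomog h F2 n => (val p)@_a : F2^o) L'.
exact: (lfunE g).
Qed.

Fact steenrod_dualE n (f : homology n) theta d (p : dhomog h F2 d) :
  steenrod_dual f theta d p = f (homog_part n (steenrod_act theta (val p))).
Proof.
set F := fun p : dhomog h F2 d => f (homog_part n (steenrod_act theta (val p))).
have L : linear F by move=> c p' q; rewrite /F /= !linearP.
pose L' := GRing.isLinear.Build _ _ _ _ _ L.
pose g : {linear dhomog h F2 d -> F2^o} := HB.pack F L'.
exact: (lfunE g).
Qed.

Fact steenrod_dual_is_linear n theta d :
  linear (fun f : homology n => steenrod_dual f theta d).
Proof.
move=> c f g; apply/lfunP => p.
by rewrite !(add_lfunE, scale_lfunE, steenrod_dualE).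
Qed.

Fact annihilatedP n (f : homology n) :
  annihilated f <->
  forall d k (p : dhomog h F2 d), (d + k = n)%N -> (0 < k)%N ->
    f (homog_part n (Sq k (val p))) = 0.
Proof.
split=> [hf d k p dk k0|hf d k theta dk k0 htheta].
  have := hf d k << fmu k >> dk k0 (steenrod_homog_Sq k).
  by move/lfunP/(_ p); rewrite steenrod_dualE steenrod_act_Sq lfunE.
apply/lfunP => p; rewrite steenrod_dualE lfunE /= /steenrod_act.
rewrite linear_sum linear_sum big_seq big1 // => w /(allP htheta) /eqP hw.
rewrite !linearZ /=; apply/eqP; rewrite scaler_eq0; apply/orP; right.
move: (w : seq nat) hw => {w} w; elim: w => [|[|j] w IHw] /= hw.
- by rewrite -hw in k0.
- by rewrite Sq0 IHw.
apply/eqP; pose q := DHomog (Sqs_dhomog w (dhomog_is_dhomog p)).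
by apply: (hf _ j.+1 q); rewrite // -addnA [(_ + j.+1)%N]addnC hw.
Qed.

Fact Ann_subspace n :
  {U : {vspace homology n} | forall f, f \in U <-> annihilated f}.
Proof.
pose T k d : 'Hom(homology n, homology d) :=
  linfun (fun f : homology n => steenrod_dual f << fmu k >> d).
exists (\bigcap_(d < n) lker (T (n - d)%N d))%VS => f.
have TE k d : T k d f = steenrod_dual f << fmu k >> d.
  pose L' := GRing.isLinear.Build _ _ _ _ _
    (@steenrod_dual_is_linear n << fmu k >> d).
  pose g : {linear homology n -> homology d} :=
    HB.pack (fun f : homology n => steenrod_dual f << fmu k >> d) L'.
  exact: (lfunE g).
split=> [/subv_bigcapP hf|hf].
  apply/annihilatedP => d k p dk k0.
  have ltd : (d < n)%N by rewrite -dk -[X in (X < _)%N]addn0 ltn_add2l.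
  have := hf (Ordinal ltd) isT; rewrite -memvE memv_ker TE /= => /eqP.
  move/lfunP/(_ p); rewrite steenrod_dualE steenrod_act_Sq lfunE /=.
  by have -> : (n - d)%N = k by rewrite -dk addKn.
rewrite memvE; apply/subv_bigcapP => d _; rewrite -memvE memv_ker TE.
apply/eqP; apply: (hf d (n - d)%N).
- by rewrite subnKC // ltnW.
- by rewrite subn_gt0.
exact: steenrod_homog_Sq.
Qed.

Definition Ann n : {vspace homology n} := sval (Ann_subspace n).

Lemma AnnP n (f : homology n) : f \in Ann n <-> annihilated f.
Proof. exact: (svalP (Ann_subspace n)). Qed.

(** Linear substitutions: g . t_i = \sum_j g_{ji} t_j, a left action; the
    dual action is (g . f)(p) = f (g^-1 . p). *)
Definition gl_act (g : {'GL_h[F2]}) (p : {mpoly F2[h]}) : {mpoly F2[h]} :=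
  p \mPo [tuple \sum_(j < h) GLval g j i *: 'X_j | i < h].

Definition gl_dual n (g : {'GL_h[F2]}) (f : homology n) : homology n :=
  linfun (fun p : dhomog h F2 n => f (homog_part n (gl_act g^-1%g (val p)))).

HB.instance Definition _ g := GRing.Linear.copy (gl_act g)
  (fun p => p \mPo [tuple \sum_(j < h) GLval g j i *: 'X_j | i < h]).
HB.instance Definition _ g := GRing.RMorphism.copy (gl_act g)
  (fun p => p \mPo [tuple \sum_(j < h) GLval g j i *: 'X_j | i < h]).

Fact gl_actX g i : gl_act g 'X_i = \sum_(j < h) GLval g j i *: 'X_j.
Proof. by rewrite /gl_act comp_mpolyXU -tnth_nth tnth_mktuple. Qed.

Fact mpoly_rmorph_ext (f g : {lrmorphism {mpoly F2[h]} -> {mpoly F2[h]}}) :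
  (forall i, f 'X_i = g 'X_i) -> f =1 g.
Proof.
move=> fg p; rewrite [p]mpolyE !linear_sum; apply: eq_bigr => a _.
rewrite !linearZ /= mpolyXE_id !rmorph_prod; congr (_ *: _).
by apply: eq_bigr => i _; rewrite !rmorphXn /= fg.
Qed.

Fact gl_act1 p : gl_act 1%g p = p.
Proof.
have := @mpoly_rmorph_ext (gl_act 1%g) idfun; apply => i /=.
rewrite gl_actX (bigD1 i) //= big1 ?addr0 => [|j ji]; rewrite mxE.
  by rewrite eqxx scale1r.
by rewrite (negPf ji) scale0r.
Qed.

Fact gl_actM g g' p : gl_act (g * g')%g p = gl_act g (gl_act g' p).
Proof.
have := @mpoly_rmorph_ext (gl_act (g * g')%g) (gl_act g \o gl_act g').
apply => i /=; rewrite !gl_actX linear_sum /=.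
under [RHS]eq_bigr do rewrite linearZ /= gl_actX scaler_sumr.
rewrite exchange_big /=; apply: eq_bigr => j _.
rewrite mxE scaler_suml; apply: eq_bigr => k _.
by rewrite scalerA mulrC.
Qed.

Fact gl_act_dhomog g d p : p \is d.-homog -> gl_act g p \is d.-homog.
Proof.
move: p; apply: (@dhomog_ind _ _ (fun p => gl_act g p \is d.-homog)).
  by rewrite linear0 dhomog0.
move=> c a q <- hq; rewrite linearP rpredD //; apply: rpredZ => /=.
rewrite mpolyXE_id rmorph_prod mdegE.
pose Q (d : nat) (p : {mpoly F2[h]}) := p \is d.-homog.
apply: (big_rec2 Q); first exact: dhomog1.
move=> i e p _; rewrite rmorphXn /= gl_actX; apply: dhomogM.
rewrite -[X in X.-homog]mul1n; apply: dhomogMn.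
by apply: rpred_sum => j _; rewrite rpredZ // dhomogX /= mdeg1.
Qed.

Fact gl_act_total_Sq g p : gl_act g (total_Sq p) = total_Sq (gl_act g p).
Proof.
have := @mpoly_rmorph_ext (gl_act g \o @total_Sq h) (@total_Sq h \o gl_act g).
apply => i /=; rewrite total_SqX rmorphD rmorphXn /= gl_actX linear_sum /=.
under [RHS]eq_bigr do rewrite linearZ /= total_SqX scalerDr.
rewrite big_split /=; congr (_ + _).
rewrite (big_morph (fun p => p ^+ 2) (@sqrrD_F2 h) (expr0n _ 2)).
by apply: eq_bigr => j _; rewrite exprZn F2_idem.
Qed.

Fact gl_act_pihomog g d p :
  gl_act g (pihomog mdeg d p) = pihomog mdeg d (gl_act g p).
Proof.
elim/mpolyind: p => [|c a p _ _ IHp]; first by rewrite !linear0.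
rewrite !linearP /= IHp; congr (_ *: _ + _).
have ha : gl_act g 'X_[a] \is (mdeg a).-homog.
  by apply: gl_act_dhomog; rewrite dhomogX.
rewrite pihomogX; case: eqP => [<-|/eqP ne] /=; first by rewrite pihomog_dE.
by rewrite (pihomog_ne0 ne) // linear0.
Qed.

Lemma gl_act_Sq g k p : gl_act g (Sq k p) = Sq k (gl_act g p).
Proof.
elim/mpolyind: p => [|c a p _ _ IHp]; first by rewrite !linear0.
rewrite !linearP /= IHp; congr (_ *: _ + _).
have ha : ('X_[a] : {mpoly F2[h]}) \is (mdeg a).-homog by rewrite dhomogX.
rewrite (Sq_dhomogE _ ha) (Sq_dhomogE _ (gl_act_dhomog g ha)).
by rewrite gl_act_pihomog gl_act_total_Sq.
Qed.

Fact gl_dualE n g (f : homology n) (p : dhomog h F2 n) :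
  gl_dual g f p = f (homog_part n (gl_act g^-1%g (val p))).
Proof.
set F := fun p : dhomog h F2 n => f (homog_part n (gl_act g^-1%g (val p))).
have L : linear F by move=> c p' q; rewrite /F /= !linearP.
pose L' := GRing.isLinear.Build _ _ _ _ _ L.
pose G : {linear dhomog h F2 n -> F2^o} := HB.pack F L'.
exact: (lfunE G).
Qed.

Fact gl_dual_is_linear n g : linear (@gl_dual n g).
Proof.
move=> c f f'; apply/lfunP => p.
by rewrite !(add_lfunE, scale_lfunE, gl_dualE).
Qed.

HB.instance Definition _ n g :=
  GRing.isLinear.Build F2 (homology n) (homology n) _ (@gl_dual n g)
    (@gl_dual_is_linear n g).

Fact Ann_gl n g (f : homology n) : f \in Ann n -> gl_dual g f \in Ann n.
Proof.
move=> /AnnP/annihilatedP hf; apply/AnnP/annihilatedP => d k p dk k0.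
rewrite gl_dualE /= gl_act_pihomog gl_act_Sq.
pose q := DHomog (gl_act_dhomog g^-1%g (dhomog_is_dhomog p)).
have <- := hf d k q dk k0; congr (f _); apply: val_inj => /=.
by rewrite pihomog_id.
Qed.

Definition Ann_act n (g : {'GL_h[F2]}) (z : subvs_of (Ann n)) :
    subvs_of (Ann n) :=
  Subvs (Ann_gl g (subvsP z)).

Fact Ann_act_is_linear n g : linear (@Ann_act n g).
Proof. by move=> c y z; apply: val_inj; rewrite /= !linearP. Qed.

HB.instance Definition _ n g :=
  GRing.isLinear.Build F2 (subvs_of (Ann n)) (subvs_of (Ann n)) _ (@Ann_act n g)
    (@Ann_act_is_linear n g).

(** Z/2 (x)_GL Ann is the quotient of Ann by the span of all g z - z. *)
Definition coinv_rel n : {vspace subvs_of (Ann n)} :=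
  (\sum_(g : {'GL_h[F2]}) limg (linfun (@Ann_act n g) - \1%VF))%VS.

Definition coinvariants n := vquot (coinv_rel n).

HB.instance Definition _ n := Vector.on (coinvariants n).

Definition coinv_class n (f : homology n) (fAnn : f \in Ann n) : coinvariants n :=
  vquot_pi (coinv_rel n) (Subvs fAnn).

End Homology.

(* Main.v *)
From Stdlib Require Import NArith FMapPositive.
Require Import Defs.
From HB Require Import structures.
From mathcomp Require Import all_boot all_order all_algebra all_fingroup.
From mathcomp Require generic_quotient.
From mathcomp.multinomials Require Import mpoly.
From mathcomp Require Import zify ring.

Set Implicit Arguments.
Unset Strict Implicit.
Unset Printing Implicit Defensive.

Import GRing.Theory.
Local Open Scope ring_scope.

(** If f in degree 66 is annihilated, then so is each slice p |-> f(t_i t_j p^2)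
    in degree 32, and the slices satisfy the Koszul relations given by
    Sq^1(t_i t_j t_k p^2); if all of them vanish, p |-> f(t_1 t_2 t_3 t_4 p^2) is
    annihilated in degree 31.  Gaussian elimination in these two degrees shows
    that f is determined by 179 of its coordinates.  The class e dual to
    t_1^63 t_2^3 and 178 differences g z - z of annihilated elements have rank 179
    on these coordinates, so e spans the coinvariants.  On the other hand, the sum
    lambda of 87 suitable coordinates takes the value 1 on every g e and 0 on
    every g z for the other two elements z occurring in the differences; hence it
    is invariant, and x_1^(1) x_2^(1) x_3^(1) x_4^(63), where it takes the value 1,
    has a nonzero class. *)

(** Elimination directly in degree 66 would face 52394 monomials. Since Sq^{2k}(p^2) = (Sq^k p)^2,
    splitting a monomial into its parity pattern and a square halves the degree, and 6545 and 5984
    monomials remain in degrees 32 and 31. The computations are certificates: only the soundness of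
    the row operations is proved, and a defect in the recorded data could only make a check fail.
    The values of lambda on the translates g e need no run over the 20160 group elements. The dual
    of t_1^63 t_2^3 sees only the coefficients of t_1 and t_2 in the substituted forms, that is, two
    rows of g^-1, which leaves 15 * 14 pairs of distinct nonzero rows. For the other two elements
    the vanishing is a parity argument on the two lowest binary digits of the exponents, uniform in
    g. *)

(** * Gaussian elimination on sparse vectors over F_2 *)

Fixpoint pos_cmp (p q : positive) : comparison :=
  match p, q with
  | xI p', xI q' | xO p', xO q' => pos_cmp p' q'
  | xH, xH => Eq
  | xH, _ | xO _, xI _ => Lt
  | _, _ => Gt
  end.

(* A sparse vector is the list of its keys, decreasing for [pos_cmp]; the order
   only matters for cancellation to be complete, not for soundness. *)
Fixpoint vec_add (u : seq positive) : seq positive -> seq positive :=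
  match u with
  | [::] => id
  | k :: u' =>
    fix add_u v := match v with
    | [::] => u
    | l :: v' =>
      match pos_cmp k l with
      | Eq => vec_add u' v'
      | Lt => l :: add_u v'
      | Gt => k :: vec_add u' v
      end
    end
  end.

Definition table := PositiveMap.t (seq positive).

(* An entry (k, r) of a table rewrites k to r.  Out of fuel, the vector is
   returned as it is, which is sound. *)
Fixpoint reduce (fuel : nat) (t : table) (v : seq positive) :=
  if fuel is fuel'.+1 then
    if v is k :: v' then
      if PositiveMap.find k t is Some r then reduce fuel' t (vec_add v' r)
      else k :: reduce fuel' t v'
    else [::]
  else v.

Definition normal_form := reduce 2000.

(** The vector stands for the relation [vec_val v = 0], which is solved for its leading key; over
    F_2 no sign or scalar appears. *)
Definition insert (t : table) v :=
  if normal_form t v is k :: r then PositiveMap.add k r t else t.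

Section SparseVectors.
Variable phi : positive -> F2.

Definition vec_val v := \sum_(k <- v) phi k.

Definition sound (t : table) :=
  forall k r, PositiveMap.find k t = Some r -> phi k = vec_val r.

Lemma addF2 (x : F2) : x + x = 0.
Proof. by rewrite -mulr2n; apply: (mulrn_pchar (pchar_Fp (isT : prime 2))). Qed.

Lemma pos_cmp_eq p q : pos_cmp p q = Eq -> p = q.
Proof.
by elim: p q => [p IHp|p IHp|] [q|q|] //= /IHp->.
Qed.

Lemma vec_val_cons k v : vec_val (k :: v) = phi k + vec_val v.
Proof. exact: big_cons. Qed.

Lemma vec_val_add u v : vec_val (vec_add u v) = vec_val u + vec_val v.
Proof.
elim: u v => [v|k u IHu]; first by rewrite /vec_val big_nil add0r.
elim=> [|l v IHv]; first by rewrite /= /vec_val big_nil addr0.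
rewrite /=; case E: (pos_cmp k l); rewrite !vec_val_cons.
- by rewrite IHu (pos_cmp_eq E) addrACA addF2 add0r.
- by rewrite IHv vec_val_cons addrCA.
- by rewrite IHu vec_val_cons addrA.
Qed.

Lemma vec_val_reduce n t v : sound t -> vec_val (reduce n t v) = vec_val v.
Proof.
move=> st; elim: n v => [|n IHn] [|k v] //=.
case E: (PositiveMap.find k t) => [r|]; rewrite ?vec_val_cons IHn //.
by rewrite vec_val_add (st _ _ E) addrC.
Qed.

Lemma vec_val_normal_form t v : sound t -> vec_val (normal_form t v) = vec_val v.
Proof. exact: vec_val_reduce. Qed.

Lemma sound_empty : sound (PositiveMap.empty _).
Proof. by move=> k r; rewrite PositiveMap.gempty. Qed.

Lemma sound_insert t v : sound t -> vec_val v = 0 -> sound (insert t v).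
Proof.
rewrite /insert => st v0; have := vec_val_normal_form v st; rewrite v0.
case: (normal_form t v) => // k r kr0 l s.
case: (Pos.eq_dec k l) => [<-|/nesym nkl].
  rewrite PositiveMap.gss => -[<-].
  move/eqP: kr0; rewrite vec_val_cons addr_eq0 => /eqP ->.
  by apply/eqP; rewrite eq_sym -addr_eq0 addF2.
by rewrite PositiveMap.gso // => /st.
Qed.

Lemma sound_foldl (T : eqType) (f : table -> T -> table) (s : seq T) t :
  (forall t x, x \in s -> sound t -> sound (f t x)) -> sound t ->
  sound (foldl f t s).
Proof.
elim: s t => //= x s IHs t hf st; apply: IHs => [u y ys|].
  by apply: hf; rewrite inE ys orbT.
by apply: hf; rewrite ?mem_head.
Qed.

End SparseVectors.

(** * Steenrod squares of monomials in four variables *)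

Notation P4 := {mpoly F2[4]}.

Fixpoint Nsum (e : seq N) : N := if e is a :: e' then N.add a (Nsum e') else 0%num.

(** Generic in the bases [ys], because the variables, their total squares t + t^2 and arbitrary
    linear forms are all substituted. *)
Fixpoint mon (R : comNzRingType) (ys : seq R) (e : seq N) : R :=
  if ys is y :: ys' then
    if e is a :: e' then y ^+ N.to_nat a * mon ys' e' else 1
  else 1.

Definition vars : seq P4 := [seq 'X_i | i <- enum 'I_4].

Definition mnm_of (e : seq N) : 'X_{1..4} := [multinom N.to_nat (nth 0%num e i) | i < 4].

Lemma mon_vars e : size e = 4%N -> mon vars e = 'X_[mnm_of e].
Proof.
case: e => [|a [|b [|c [|d []]]]] // _.
rewrite mpolyXE_id !big_ord_recl big_ord0 /vars !enum_ordSl enum_ord0 !mnmE /=.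
by rewrite !mulr1.
Qed.

Lemma mdeg_mnm_of e : size e = 4%N -> mdeg (mnm_of e) = N.to_nat (Nsum e).
Proof.
case: e => [|a [|b [|c [|d []]]]] // _.
rewrite mdegE !big_ord_recl big_ord0 !mnmE /=; lia.
Qed.

Definition expo_of (m : 'X_{1..4}) : seq N := [seq N.of_nat (m i) | i <- enum 'I_4].

Lemma expo_ofK m : mnm_of (expo_of m) = m.
Proof.
apply/mnmP => i; rewrite mnmE (nth_map i) ?size_enum_ord //.
by rewrite nth_ord_enum Nnat.Nat2N.id.
Qed.

Lemma size_expo_of m : size (expo_of m) = 4%N.
Proof. by rewrite size_map size_enum_ord. Qed.

(* The exponents in the expansion of (x + x^2)^b. *)
Fixpoint pos_sq_exps (b : positive) : seq N :=
  match b with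
  | xH => [:: 1; 2]%num
  | xO b' => [seq N.double e | e <- pos_sq_exps b']
  | xI b' => flatten [seq [:: N.succ_double e; N.double (N.succ e)] | e <- pos_sq_exps b']
  end.

Definition sq_exps (b : N) := if b is Npos p then pos_sq_exps p else [:: 0%num].

(** By Frobenius, (x + x^2)^(2b) is (x^2 + x^4)^b, so the binary digits of the exponent are peeled
    off one at a time. *)
Lemma sq_expsE (x : P4) b :
  (x + x ^+ 2) ^+ N.to_nat b = \sum_(e <- sq_exps b) x ^+ N.to_nat e.
Proof.
case: b => [|b] /=; first by rewrite big_seq1.
elim: b x => [b IHb|b IHb|] x.
- have -> : Pos.to_nat b~1 = (Pos.to_nat b).*2.+1 by lia.
  rewrite exprS -muln2 mulnC exprM sqrrD_F2 IHb big_distrr /= big_flatten.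
  rewrite big_map; apply: eq_bigr => e _; rewrite /= big_cons big_seq1.
  rewrite -!exprM mulrDl -exprS -exprD; congr (_ ^+ _ + _ ^+ _); lia.
- have -> : Pos.to_nat b~0 = (2 * Pos.to_nat b)%N by lia.
  rewrite exprM sqrrD_F2 IHb big_map; apply: eq_bigr => e _.
  by rewrite -exprM; congr (_ ^+ _); lia.
by rewrite big_cons big_seq1.
Qed.

(** The exponents, with multiplicity, in the degree [r] part of the total square of t^bs. The total
    square never lowers an exponent, so the later variables use at least [s]; the test prunes
    accordingly and keeps the truncated subtraction exact. *)
Fixpoint sq_terms (bs : seq N) (r : N) : seq (seq N) :=
  if bs is b :: bs' then
    let s := Nsum bs' in
    flatten [seq if N.leb (N.add e s) r then [seq e :: es | es <- sq_terms bs' (N.sub r e)]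
                 else [::] | e <- sq_exps b]
  else if r is N0 then [:: [::]] else [::].

Lemma sq_exps_ge b e : e \in sq_exps b -> (b <= e)%num.
Proof.
case: b => [|b] /=; first by rewrite inE => /eqP->.
elim: b e => [b IHb|b IHb|] e /=.
- by case/flatten_mapP => d /IHb bd; rewrite !inE => /orP[] /eqP->; lia.
- by case/mapP => d /IHb bd ->; lia.
- by rewrite !inE => /orP[] /eqP->; lia.
Qed.

Lemma sq_terms_lt bs r : (r < Nsum bs)%num -> sq_terms bs r = [::].
Proof.
case: bs => [|b bs] /= lt_r; first by lia.
elim: (sq_exps b) (@sq_exps_ge b) => //= e s IHs ge_b.
rewrite ifF; first by apply: IHs => x xs; apply: ge_b; rewrite inE xs orbT.
by have := ge_b e (mem_head _ _); lia.
Qed.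

Lemma pihomog_Xn (i : 'I_4) a r (q : P4) :
  pihomog mdeg r ('X_i ^+ a * q) =
  if (a <= r)%N then 'X_i ^+ a * pihomog mdeg (r - a) q else 0.
Proof.
have hom j : pihomog mdeg j ('X_i ^+ a : P4) = if (a == j)%N then 'X_i ^+ a else 0.
  by rewrite mpolyXn pihomogX /= mdegMn mdeg1 mul1n.
rewrite pihomogM; case: ifP => [le_ar|/negbT]; last first.
  rewrite -ltnNge => lt_ra; apply: big1 => j _; rewrite hom.
  by case: eqP => [ea|_]; rewrite ?mul0r //; have := ltn_ord j; lia.
have ltar : (a < r.+1)%N by [].
rewrite (bigD1 (Ordinal ltar)) //= hom eqxx big1 ?addr0 // => j.
by rewrite -val_eqE /= hom eq_sym => /negPf->; rewrite mul0r.
Qed.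

Lemma sq_termsE (s : seq 'I_4) bs r : size s = size bs ->
  pihomog mdeg (N.to_nat r) (mon [seq ('X_i + 'X_i ^+ 2 : P4) | i <- s] bs) =
  \sum_(e <- sq_terms bs r) mon [seq ('X_i : P4) | i <- s] e.
Proof.
elim: bs s r => [|b bs IHb] [|i s] r //= => [_|[/IHb{}IHb]].
  rewrite -mpolyX0 pihomogX /= mdeg0; case: r => [|p]; first by rewrite big_seq1 mpolyX0.
  by rewrite big_nil ltn_eqF //; lia.
rewrite sq_expsE big_flatten big_map mulr_suml linear_sum /=.
apply: eq_bigr => e _; rewrite pihomog_Xn.
have -> : (N.to_nat e <= N.to_nat r)%N = N.leb e r by lia.
have [le_er|gt_er] := boolP (N.leb e r); last by rewrite ifF ?big_nil //; lia.
have -> : (N.to_nat r - N.to_nat e = N.to_nat (r - e))%N by lia.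
rewrite IHb; case: ifP => [_|gt]; first by rewrite big_map /= -mulr_sumr.
by rewrite sq_terms_lt ?big_nil ?mulr0 //; lia.
Qed.

Lemma total_Sq_mon e : total_Sq (mon vars e) = mon [seq ('X_i + 'X_i ^+ 2 : P4) | i <- enum 'I_4] e.
Proof.
rewrite /vars; elim: (enum 'I_4) e => [|i s IHs] [|a e] /=; rewrite ?rmorph1 //.
by rewrite rmorphM rmorphXn /= total_SqX IHs.
Qed.

Lemma Sq_mon b k n : size b = 4%N -> (N.to_nat (Nsum b) + k)%N = N.to_nat n ->
  Sq k (mon vars b) = \sum_(e <- sq_terms b n) mon vars e.
Proof.
move=> sb dn; rewrite -sq_termsE ?size_enum_ord // -total_Sq_mon -dn.
by apply: Sq_dhomogE; rewrite mon_vars // dhomogX /= mdeg_mnm_of.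
Qed.

Lemma size_sq_terms b n e : e \in sq_terms b n -> size e = size b.
Proof.
elim: b n e => [|b bs IHb] n e /=; first by case: n; rewrite // inE => /eqP->.
case/flatten_mapP => a _; case: ifP => // _ /mapP[es /IHb ses ->] /=.
by rewrite ses.
Qed.

Lemma Nsum_sq_terms b n e : e \in sq_terms b n -> Nsum e = n.
Proof.
elim: b n e => [|b bs IHb] n e /=; first by case: n; rewrite // inE => /eqP->.
case/flatten_mapP => a _; case: ifP => // an /mapP[es /IHb ses ->] /=.
by rewrite ses; lia.
Qed.

(** * Functionals killing the hit polynomials, and their slices *)

Section SquareOfSquare.
Variable h : nat.
Implicit Types p q : {mpoly F2[h]}.

Lemma pihomog_sqr e p :
  pihomog mdeg e (p ^+ 2) = if odd e then 0 else pihomog mdeg e./2 p ^+ 2.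
Proof.
elim/mpolyind: p => [|c a p _ _ IHp].
  by rewrite expr0n !linear0 expr0n if_same.
rewrite sqrrD_F2 !linearD /= IHp sqrrD_F2 exprZn mpolyXn !linearZ /= exprZn.
rewrite !pihomogX /= mdegMn; case: (boolP (odd e)) => oe.
  by rewrite ifF ?scaler0 ?addr0 //; lia.
congr (_ *: _ + _); have -> : (mdeg a == e./2) = ((mdeg a * 2)%N == e) by lia.
by case: ifP => _; rewrite ?mpolyXn ?expr0n.
Qed.

(** The total square is a ring morphism, hence commutes with squaring; comparing degrees on
    monomials gives the halving. *)
Lemma Sq_sqr k p : Sq k (p ^+ 2) = if odd k then 0 else Sq k./2 p ^+ 2.
Proof.
elim/mpolyind: p => [|c a p _ _ IHp].
  by rewrite expr0n !linear0 expr0n if_same.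
rewrite sqrrD_F2 !linearD /= IHp sqrrD_F2 exprZn !linearZ /= exprZn.
have ha : ('X_[a] : {mpoly F2[h]}) \is (mdeg a).-homog by rewrite dhomogX.
have ha2 : ('X_[a] ^+ 2 : {mpoly F2[h]}) \is (mdeg a * 2).-homog.
  by rewrite mpolyXn dhomogX /= mdegMn.
rewrite (Sq_dhomogE _ ha2) (Sq_dhomogE _ ha) rmorphXn /= pihomog_sqr oddD oddM andbF /=.
have -> : (mdeg a * 2 + k)./2 = (mdeg a + k./2)%N by lia.
by case: ifP => _; rewrite ?scaler0 ?addr0.
Qed.

End SquareOfSquare.

Section Killing.
Implicit Types (L : P4 -> F2) (p q : P4).

(** The functional is defined on all polynomials instead of one degree, so that a slice is again
    such a functional without transport between degrees. Over F_2, additivity is linearity. *)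
Definition killing n L :=
  {morph L : p q / p + q} /\
  forall d k p, p \is d.-homog -> (d + k = n)%N -> (0 < k)%N -> L (Sq k p) = 0.

Lemma killing0 n L : killing n L -> L 0 = 0.
Proof. by case=> LD _; apply: (addrI (L 0)); rewrite -LD !addr0. Qed.

Lemma killing_sum n L I (r : seq I) (F : I -> P4) :
  killing n L -> L (\sum_(i <- r) F i) = \sum_(i <- r) L (F i).
Proof. by move=> kL; apply: big_morph; [case: kL | apply: killing0 kL]. Qed.

Lemma killing_sqr n L p : killing (n + n) L -> (0 < n)%N -> p \is n.-homog -> L (p ^+ 2) = 0.
Proof. by case=> _ kL n0 hp; rewrite -(Sq_top hp) (kL n). Qed.

Lemma dhomogX1 (i : 'I_4) : ('X_i : P4) \is 1.-homog.
Proof. by rewrite dhomogX /= mdeg1. Qed.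

Lemma dhomog_sqr d p : p \is d.-homog -> p ^+ 2 \is (d + d).-homog.
Proof. by move=> hp; rewrite expr2; apply: dhomogM. Qed.

Lemma dhomogXX (i j : 'I_4) : ('X_i * 'X_j : P4) \is 2.-homog.
Proof. exact: (dhomogM (dhomogX1 i) (dhomogX1 j)). Qed.

Lemma Sq_mul_sqr k (u p : P4) :
  Sq k.*2 (u * p ^+ 2) = \sum_(m < k.+1) Sq m.*2 u * Sq (k - m) p ^+ 2.
Proof.
rewrite Sq_cartan.
have sum_even F l : (forall m, (m < l)%N -> F m.*2.+1 = 0 :> P4) ->
    \sum_(i < l.*2.+1) F i = \sum_(m < l.+1) F m.*2.
  elim: l => [|l IHl] F0; first by rewrite !big_ord_recr !big_ord0.
  rewrite doubleS big_ord_recr /= big_ord_recr /= F0 // addr0.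
  by rewrite IHl => [|m ml]; rewrite ?[RHS]big_ord_recr // F0 // ltnS ltnW.
rewrite (sum_even (fun i => Sq i u * Sq (k.*2 - i) (p ^+ 2))) => [|m lt_mk].
  apply: eq_bigr => m _; rewrite Sq_sqr -doubleB odd_double doubleK //.
by rewrite Sq_sqr ifT ?mulr0 //; lia.
Qed.

(** Sq^{2k}(t_i t_j p^2) is t_i t_j (Sq^k p)^2 plus the square of t_i t_j Sq^{k-1} p. The latter has
    its root in degree n+1, hence is a top square, which [L] kills. *)
Lemma killing_pair n L (i j : 'I_4) :
  killing (n.+1 + n.+1) L -> killing n (fun p => L ('X_i * 'X_j * p ^+ 2)).
Proof.
move=> kL; split=> [p q|d k p hp dk k0].
  by rewrite sqrrD_F2 mulrDr; case: kL.
have hu := dhomogXX i j; have hup := dhomogM hu (dhomog_sqr hp).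
have := kL.2 _ k.*2 _ hup; rewrite Sq_mul_sqr big_ord_recl /= Sq0 subn0 kL.1.
rewrite (killing_sum _ _ kL) big1 ?addr0 => [-> //|[m ltmk] _] /=; try lia.
case: m ltmk => [|m] ltmk; last by rewrite (Sq_unstable hu) ?mul0r ?(killing0 kL) //; lia.
rewrite /bump /= (Sq_top hu) -exprMn (killing_sqr kL) // -dk.
have -> : ((d + k).+1 = 2 + (d + (k - 1)))%N by lia.
exact/dhomogM/Sq_dhomog.
Qed.

Lemma Sq1_XXX (i j l : 'I_4) (p : P4) :
  Sq 1 ('X_i * 'X_j * 'X_l * p ^+ 2) = 'X_j * 'X_l * ('X_i * p) ^+ 2 +
  'X_i * 'X_l * ('X_j * p) ^+ 2 + 'X_i * 'X_j * ('X_l * p) ^+ 2.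
Proof.
have Sq1M (a b : P4) : Sq 1 (a * b) = Sq 1 a * b + a * Sq 1 b.
  by rewrite Sq_cartan !big_ord_recl big_ord0 /= !Sq0 addr0 addrC.
rewrite (Sq1M _ (p ^+ 2)) (Sq1M ('X_i * 'X_j)) (Sq1M 'X_i) Sq_sqr /= !(Sq_top (dhomogX1 _)).
ring.
Qed.

Lemma killing_koszul n L (i j l : 'I_4) p :
  killing (n + n + 4) L -> p \is n.-homog ->
  L ('X_j * 'X_l * ('X_i * p) ^+ 2) + L ('X_i * 'X_l * ('X_j * p) ^+ 2) +
  L ('X_i * 'X_j * ('X_l * p) ^+ 2) = 0.
Proof.
move=> kL hp; rewrite -!kL.1 -Sq1_XXX.
have hu := dhomogM (dhomogXX i j) (dhomogX1 l).
by apply: (kL.2 _ _ _ (dhomogM hu (dhomog_sqr hp))); lia.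
Qed.

(** Brings the Sq^2 term of the Cartan formula on t_a t_b t_c t_d p^2 into six terms, each with the
    shape of a pair slice. *)
Lemma Sq2_XXXX (a b c d p : P4) :
    [/\ a \is 1.-homog, b \is 1.-homog, c \is 1.-homog & d \is 1.-homog] ->
  Sq 2 (a * b * (c * d)) * p ^+ 2 =
  a * b * (c * d * p) ^+ 2 + c * d * (a * b * p) ^+ 2 + b * d * (a * c * p) ^+ 2 +
  b * c * (a * d * p) ^+ 2 + a * d * (b * c * p) ^+ 2 + a * c * (b * d * p) ^+ 2.
Proof.
case=> ha hb hc hd.
have Sq1M (x y : P4) : x \is 1.-homog -> y \is 1.-homog ->
    Sq 1 (x * y) = x ^+ 2 * y + x * y ^+ 2.
  move=> hx hy; rewrite Sq_cartan !big_ord_recl big_ord0 /= !Sq0 addr0 addrC.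
  by rewrite (Sq_top hx) (Sq_top hy).
rewrite Sq_cartan !big_ord_recl big_ord0 /= /bump /= !Sq0 !Sq1M //.
rewrite (Sq_top (dhomogM ha hb)) (Sq_top (dhomogM hc hd)); ring.
Qed.

(** Here the Cartan formula leaves two extra terms. The one with Sq^4 of the four variables is a top
    square; the one with Sq^2 is a sum of pair slices, which is why these have to vanish
    beforehand. *)
Lemma killing_quad n L (a b c d : 'I_4) :
    killing (n.+2 + n.+2) L ->
    (forall (i j : 'I_4) q, q \is n.+1.-homog -> L ('X_i * 'X_j * q ^+ 2) = 0) ->
  killing n (fun p => L ('X_a * 'X_b * ('X_c * 'X_d) * p ^+ 2)).
Proof.
move=> kL L2; split=> [p q|e k p hp ek k0].
  by rewrite sqrrD_F2 mulrDr; case: kL.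
have hu := dhomogM (dhomogXX a b) (dhomogXX c d).
have := kL.2 _ k.*2 _ (dhomogM hu (dhomog_sqr hp)).
rewrite Sq_mul_sqr big_ord_recl /= Sq0 subn0 kL.1.
rewrite (killing_sum _ _ kL) big1 ?addr0 => [-> //|[m ltmk] _] /=; try lia.
rewrite /bump add1n; case: m ltmk => [|[|m]] ltmk.
- have hq (i j : 'I_4) : 'X_i * 'X_j * Sq (k - 1) p \is n.+1.-homog.
    have -> : (n.+1 = 2 + (e + (k - 1)))%N by lia.
    exact: dhomogM (dhomogXX i j) (Sq_dhomog _ hp).
  have L2q (i j i' j' : 'I_4) :
      L ('X_i * 'X_j * ('X_i' * 'X_j' * Sq (k - 1) p) ^+ 2) = 0.
    exact: L2 _ _ _ (hq i' j').
  rewrite [X in L X](Sq2_XXXX _ (And4 (dhomogX1 a) (dhomogX1 b) (dhomogX1 c) (dhomogX1 d))).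
  rewrite 5!kL.1.
  have add00 (x y : F2) : x = 0 -> y = 0 -> x + y = 0 by move=> -> ->; rewrite addr0.
  by do 5![apply: (add00 _ _ _ (L2q _ _ _ _))]; exact: L2q.
- rewrite (Sq_top hu) -exprMn (killing_sqr kL) //.
  have -> : (n.+2 = 4 + (e + (k - 2)))%N by lia.
  exact/dhomogM/Sq_dhomog.
- by rewrite (Sq_unstable hu) ?mul0r ?(killing0 kL) //; lia.
Qed.

End Killing.

(** * Tables of hit relations *)

Definition Nupto (d : N) : seq N := [seq N.of_nat i | i <- iota 0 (N.to_nat d).+1].

Fixpoint expos (h : nat) (d : N) : seq (seq N) :=
  if h is h'.+1 then
    flatten [seq [seq a :: e | e <- expos h' (N.sub d a)] | a <- Nupto d]
  else if d is N0 then [:: [::]] else [::].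

(* Base 64 digits after a leading 1; the last exponent is recovered from the
   degree by [expo_at]. *)
Definition key (e : seq N) : positive :=
  if e is [:: a, b, c & _] then
    if N.add a (N.mul 64 (N.add b (N.mul 64 (N.add c 64)))) is Npos p then p else xH
  else xH.

Definition expo_at (n : N) (k : positive) : seq N :=
  let a := N.modulo (Npos k) 64 in
  let b := N.modulo (N.div (Npos k) 64) 64 in
  let c := N.modulo (N.div (Npos k) 4096) 64 in
  [:: a; b; c; N.sub n (N.add a (N.add b c))].

Definition vec (es : seq (seq N)) := foldr (fun e v => vec_add [:: key e] v) [::] es.

Definition hit_insert (n : N) (t : table) (b : seq N) : table := insert t (vec (sq_terms b n)).

(** The degree of a source t^b fixes the operation, Sq^{n-|b|}: all rows of Sq^1 and Sq^2 come
    first. The lists [bs] used below are sources in degrees n-4 and n-8, giving Sq^4 and Sq^8. *)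
Definition hit_table (n : N) (bs : seq (seq N)) : table :=
  foldl (hit_insert n) (PositiveMap.empty _)
    (expos 4 (N.sub n 1) ++ expos 4 (N.sub n 2) ++ bs).

Definition new_pivots (T : Type) (ins : table -> T -> table) (t : table) (xs : seq T) : seq T :=
  let step p x := let s := ins p.1 x in
    if PositiveMap.cardinal s == PositiveMap.cardinal p.1 then p else (s, x :: p.2) in
  rev (foldl step (t, [::]) xs).2.

Definition is_pivot (t : table) k := if PositiveMap.find k t is Some _ then true else false.

Lemma mem_expos h d e : (e \in expos h d) = (size e == h) && (Nsum e == d).
Proof.
elim: h d e => [|h IHh] d e; first by case: d e => [|d] [|a e].
apply/flatten_mapP/andP => [[a]|[/eqP]].
  move=> /mapP[i]; rewrite mem_iota => /andP[_ lti] ->.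
  case/mapP => e'; rewrite IHh => /andP[/eqP <- /eqP se ->] /=.
  by split=> //; apply/eqP; lia.
case: e => //= a e [se] /eqP ad; exists a.
  by apply/mapP; exists (N.to_nat a); [rewrite mem_iota; lia | lia].
by apply/mapP; exists e; rewrite // IHh se eqxx /=; apply/eqP; lia.
Qed.

Lemma expo_at_key n e : (n < 64)%num -> e \in expos 4 n -> expo_at n (key e) = e.
Proof.
move=> n64; rewrite mem_expos => /andP[].
case: e => [|a [|b [|c [|d []]]]] //= _ /eqP sn.
rewrite /key; set k := N.add a _.
have: k = (a + 64 * (b + 64 * (c + 64)))%num by [].
case: k => [|p] kE; first by lia.
have divmod64 x y : (x < 64)%num ->
    N.modulo (x + 64 * y) 64 = x /\ N.div (x + 64 * y) 64 = y.
  move=> x64; split; apply/esym.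
    by apply: (N.mod_unique _ _ y); lia.
  by apply: (N.div_unique _ _ _ x); lia.
rewrite /expo_at -(N.Div0.div_div _ 64 64) kE.
have [-> ->] := divmod64 a (b + 64 * (c + 64))%num ltac:(lia).
have [-> ->] := divmod64 b (c + 64)%num ltac:(lia).
(* The digit above [c] is the leading 1 of the key. *)
rewrite (_ : (c + 64)%num = c + 64 * 1)%num; last by lia.
have [-> _] := divmod64 c 1%num ltac:(lia).
congr [:: _; _; _; _]; lia.
Qed.

Section HitTable.
Variables (L : P4 -> F2) (n : N).
Hypotheses (n0 : (0 < n)%num) (n64 : (n < 64)%num) (kL : killing (N.to_nat n) L).

Definition coef_at k := L (mon vars (expo_at n k)).

Lemma vec_val_vec es : {subset es <= expos 4 n} ->
  vec_val coef_at (vec es) = \sum_(e <- es) L (mon vars e).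
Proof.
elim: es => [|e es IHes] sub; first by rewrite /vec_val !big_nil.
rewrite -[vec (e :: es)]/(vec_add [:: key e] (vec es)) vec_val_add big_cons.
rewrite IHes => [|a aes]; last first.
  by apply: sub; rewrite inE aes orbT.
by rewrite /vec_val big_seq1 /coef_at expo_at_key // sub ?mem_head.
Qed.

Lemma sound_hit_table bs : all (fun b => (size b == 4%N) && N.ltb (Nsum b) n) bs ->
  sound coef_at (hit_table n bs).
Proof.
move=> /allP hbs; apply: sound_foldl => [t b hb st|]; last exact: sound_empty.
have [sb nb] : size b = 4%N /\ (Nsum b < n)%num.
  move: hb; rewrite (mem_cat b (expos 4 _)) (mem_cat b (expos 4 _)) 2!mem_expos.
  by case/or3P => [| | /hbs] /andP[/eqP sb]; [move/eqP|move/eqP|]; split=> //; lia.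
apply: sound_insert => //.
rewrite vec_val_vec => [|e he]; last first.
  by rewrite mem_expos (size_sq_terms he) sb (Nsum_sq_terms he) !eqxx.
rewrite -(killing_sum _ _ kL) -(@Sq_mon b (N.to_nat (n - Nsum b)) n) //; last by lia.
apply: (kL.2 (N.to_nat (Nsum b))); try lia.
by rewrite mon_vars // dhomogX /= mdeg_mnm_of.
Qed.

End HitTable.

(** * Parity patterns, Koszul relations and the free coordinates *)

Fixpoint bitseqs (h : nat) : seq bitseq :=
  if h is h'.+1 then
    [seq false :: A | A <- bitseqs h'] ++ [seq true :: A | A <- bitseqs h']
  else [:: [::]].

Definition masks c : seq bitseq := [seq A <- bitseqs 4 | count id A == c].

Definition bits (A : bitseq) : seq N := [seq if s then 1%num else 0%num | s <- A].

(** Rebuilds exponents from their parities [A] and their halves [e]: the monomial is t^A (t^e)^2. *)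
Definition double_plus (A : bitseq) (e : seq N) : seq N :=
  [seq if x.1 then N.succ_double x.2 else N.double x.2 | x <- zip A e].

Definition incr i (e : seq N) := set_nth 0%num e i (N.succ (nth 0%num e i)).

(* Keys for pairs of a mask A (the support of t_i t_j) and a key. *)
Fixpoint label (A : bitseq) (k : positive) : positive :=
  if A is s :: A' then (if s then xI else xO) (label A' k) else k.

Fixpoint unlabel (h : nat) (p : positive) : bitseq * positive :=
  if h is h'.+1 then
    match p with
    | xI p' => let: (A, k) := unlabel h' p' in (true :: A, k)
    | xO p' => let: (A, k) := unlabel h' p' in (false :: A, k)
    | xH => ([::], xH)
    end
  else ([::], p).

(** The relation L(Sq^1(t_i t_j t_l m^2)) = 0 for T = {i, j, l}: removing i from [T] names the
    slice, to be taken at t_i m. Labels occupy the low binary digits, which [pos_cmp] reads first,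
    so labelling a sorted vector by one mask keeps it sorted. *)
Definition koszul_vec (vs : seq (seq positive)) (T : bitseq) : seq positive :=
  foldr (fun i v => if nth false T i then
      vec_add [seq label (set_nth false T i false) k | k <- nth [::] vs i] v
    else v) [::] (iota 0 4).

Definition incr_forms (t : table) (m : seq N) : seq (seq positive) :=
  [seq normal_form t [:: key (incr i m)] | i <- iota 0 4].

Definition koszul_insert (t s : table) (m : seq N) : table :=
  let vs := incr_forms t m in foldl (fun s T => insert s (koszul_vec vs T)) s (masks 3).

(* Among the rows and relations that could be used, only those giving new pivots
   are recorded, to shorten the checks below. *)
Definition hit_rows32 : seq (seq N) :=
  Eval vm_compute in
    new_pivots (hit_insert 32) (hit_table 32 [::]) (expos 4 28 ++ expos 4 24).

Definition hit_rows31 : seq (seq N) :=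
  Eval vm_compute in
    new_pivots (hit_insert 31) (hit_table 31 [::]) (expos 4 27 ++ expos 4 23).

Definition koszul_points : seq (seq N) :=
  Eval vm_compute in
    new_pivots (koszul_insert (hit_table 32 hit_rows32)) (PositiveMap.empty _) (expos 4 31).

Definition koszul_table (t : table) : table :=
  foldl (koszul_insert t) (PositiveMap.empty _) koszul_points.

(** The coordinates that are pivots neither of the hit relations nor of the Koszul relations. *)
Definition pair_basis : seq (bitseq * seq N) :=
  Eval vm_compute in
    let t := hit_table 32 hit_rows32 in let s := koszul_table t in
    let B := [seq e <- expos 4 32 | ~~ is_pivot t (key e)] in
    flatten [seq [seq (A, e) | e <- B & ~~ is_pivot s (label A (key e))] | A <- masks 2].

Definition quad_basis : seq (bitseq * seq N) :=
  Eval vm_compute in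
    let t := hit_table 31 hit_rows31 in
    [seq (nseq 4 true, e) | e <- expos 4 31 & ~~ is_pivot t (key e)].

(** All six slices obey the same hit relations, so one table [t] serves them all; the Koszul
    relations couple the slices and act on labelled normal forms. With the free coordinates set to
    zero, every coordinate must reduce to the empty vector. *)
Definition pair_cover : bool :=
  let t := hit_table 32 hit_rows32 in
  let s := foldl (fun s x => insert s [:: label x.1 (key x.2)]) (koszul_table t) pair_basis in
  all (fun e => let v := normal_form t [:: key e] in
      all (fun A => nilp (normal_form s [seq label A k | k <- v])) (masks 2)) (expos 4 32).

Definition quad_cover : bool :=
  let t := foldl (fun t x => insert t [:: key x.2]) (hit_table 31 hit_rows31) quad_basis in
  all (fun e => nilp (normal_form t [:: key e])) (expos 4 31).

Definition basis66 : seq (seq N) :=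
  Eval vm_compute in [seq double_plus x.1 x.2 | x <- pair_basis ++ quad_basis].

Lemma pair_coverT : pair_cover.
Proof. by vm_cast_no_check (erefl true). Qed.

Lemma quad_coverT : quad_cover.
Proof. by vm_cast_no_check (erefl true). Qed.

Lemma labelK A k : unlabel (size A) (label A k) = (A, k).
Proof. by elim: A => [|[] A IHA] //=; rewrite IHA. Qed.

(** * Slices are determined by their free coordinates *)

Section Monomials.
Variable R : comNzRingType.
Implicit Types ys : seq R.

Lemma mon_double_plus ys A e : size A = size e ->
  mon ys (double_plus A e) = mon ys (bits A) * mon ys e ^+ 2.
Proof.
rewrite /double_plus; elim: ys A e => [|y ys IHys] [|s A] [|a e] //= => [_|_|_|[sAe]];
  rewrite ?expr1n ?mulr1 //.
rewrite {}IHys // exprMn -exprM mulrACA -exprD; congr (_ ^+ _ * _).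
by case: s => /=; lia.
Qed.

Lemma mon_incr ys i e : (i < size ys)%N -> (i < size e)%N ->
  mon ys (incr i e) = nth 0 ys i * mon ys e.
Proof.
rewrite /incr; elim: i ys e => [|i IHi] [|y ys] [|a e] //= iy ie.
  by rewrite Nnat.N2Nat.inj_succ exprS mulrA.
by rewrite IHi // mulrCA.
Qed.

Definition mask2 (i j : nat) : bitseq := [seq (k == i) || (k == j) | k <- iota 0 4].

Lemma masks2E : masks 2 =
  [:: mask2 2 3; mask2 1 3; mask2 1 2; mask2 0 3; mask2 0 2; mask2 0 1].
Proof. by []. Qed.

Lemma mon_mask2 ys i j : size ys = 4%N -> (i < j < 4)%N ->
  mon ys (bits (mask2 i j)) = nth 0 ys i * nth 0 ys j.
Proof.
case: ys => [|y0 [|y1 [|y2 [|y3 []]]]] // _.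
case: i j => [|[|[|[|i]]]] [|[|[|[|j]]]] // ij; try by lia.
all: by rewrite /= ?expr0 ?expr1 ?mul1r ?mulr1.
Qed.

End Monomials.

Lemma size_vars : size vars = 4%N.
Proof. by rewrite size_map size_enum_ord. Qed.

Section Slices.
Variable L : P4 -> F2.
Hypothesis kL : killing 66 L.

Definition slice (A : bitseq) (p : P4) := L (mon vars (bits A) * p ^+ 2).

Definition pair_coef (k : positive) : F2 :=
  let: (A, l) := unlabel 4 k in slice A (mon vars (expo_at 32 l)).

Lemma size_bitseqs h A : A \in bitseqs h -> size A = h.
Proof.
elim: h A => [|h IHh] A /=; first by rewrite inE => /eqP->.
by rewrite mem_cat => /orP[] /mapP[A' /IHh sA ->] /=; rewrite sA.
Qed.

Lemma nth_vars i : (i < 4)%N -> nth 0 vars i = 'X_(inord i).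
Proof.
move=> i4; rewrite (nth_map ord0) ?size_enum_ord //; congr 'X__.
by apply: val_inj; rewrite /= nth_enum_ord ?inordK.
Qed.

Lemma pair_mask A : A \in masks 2 ->
  exists i j : 'I_4, mon vars (bits A) = 'X_i * 'X_j.
Proof.
rewrite masks2E !inE => /or4P[|||/or3P[]] /eqP->;
  by rewrite mon_mask2 ?size_vars // !nth_vars //; do 2!eexists.
Qed.

Lemma slice_killing A : A \in masks 2 -> killing 32 (slice A).
Proof.
case/pair_mask => i [j Aij]; have := @killing_pair 32 L i j kL.
by rewrite /slice Aij.
Qed.

Lemma vec_val_label A v : size A = 4%N ->
  vec_val pair_coef [seq label A k | k <- v] = vec_val (coef_at (slice A) 32) v.
Proof.
move=> sA; rewrite /vec_val big_map; apply: eq_bigr => k _.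
by rewrite /pair_coef; have := labelK A k; rewrite sA => ->.
Qed.

Lemma vec_val_key n M e : (n < 64)%num -> e \in expos 4 n ->
  vec_val (coef_at M n) [:: key e] = M (mon vars e).
Proof. by move=> n64 en; rewrite /vec_val big_seq1 /coef_at expo_at_key. Qed.

Lemma incr_expos i m d : (i < 4)%N -> m \in expos 4 d -> incr i m \in expos 4 (N.succ d).
Proof.
rewrite !mem_expos => i4 /andP[]; case: m => [|a [|b [|c [|e []]]]] //= _ /eqP <-.
by case: i i4 => [|[|[|[|]]]] //= _; apply/eqP; lia.
Qed.

(** Passing to normal forms does not change values, so the vector evaluates to the three terms of
    [killing_koszul] with p = m; the four masks [T] are the four triples of variables. *)
Lemma koszul_vec0 t T m : T \in masks 3 -> m \in expos 4 31 ->
  (forall A, A \in masks 2 -> sound (coef_at (slice A) 32) t) ->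
  vec_val pair_coef (koszul_vec (incr_forms t m) T) = 0.
Proof.
move=> T3 m31 st.
have sm : size m = 4%N by move: m31; rewrite mem_expos => /andP[/eqP].
have hp : mon vars m \is 31.-homog.
  by rewrite mon_vars // dhomogX /= mdeg_mnm_of //; move: m31;
    rewrite mem_expos => /andP[_ /eqP->].
have -> : vec_val pair_coef (koszul_vec (incr_forms t m) T) =
    \sum_(i <- iota 0 4 | nth false T i)
       L (mon vars (bits (set_nth false T i false)) * (nth 0 vars i * mon vars m) ^+ 2).
  rewrite /koszul_vec.
  have: all (fun i => i < 4)%N (iota 0 4) by [].
  elim: (iota 0 4) => [|i s IHs] /=; first by rewrite /vec_val !big_nil.
  case/andP=> i4 /IHs{}IHs; rewrite big_cons; case: ifP => // Ti.
  have T2 : set_nth false T i false \in masks 2.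
    have: all (fun T => all (fun i => nth false T i ==> (set_nth false T i false \in masks 2))
      (iota 0 4)) (masks 3) by [].
    by move/allP/(_ _ T3)/allP/(_ i); rewrite mem_iota i4 Ti; apply.
  rewrite vec_val_add IHs vec_val_label; last first.
    by apply/eqP; move: T2; rewrite mem_filter => /andP[_ /size_bitseqs->].
  rewrite (nth_map 0%N) ?size_iota // nth_iota // add0n vec_val_normal_form; last exact: st.
  rewrite (@vec_val_key 32 _ (incr i m) erefl (@incr_expos i m 31 i4 m31)).
  by rewrite /slice mon_incr ?size_vars ?sm.
have koszul i j l : (i < 4)%N -> (j < 4)%N -> (l < 4)%N ->
    L (nth 0 vars j * nth 0 vars l * (nth 0 vars i * mon vars m) ^+ 2) +
    (L (nth 0 vars i * nth 0 vars l * (nth 0 vars j * mon vars m) ^+ 2) +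
    L (nth 0 vars i * nth 0 vars j * (nth 0 vars l * mon vars m) ^+ 2)) = 0.
  by move=> i4 j4 l4; rewrite !nth_vars // addrA; apply: (@killing_koszul 31).
have masks3 : masks 3 = [:: [:: false; true; true; true]; [:: true; false; true; true];
   [:: true; true; false; true]; [:: true; true; true; false]] by [].
have pairE i j : (i < j < 4)%N ->
    mon vars (bits (mask2 i j)) = nth 0 vars i * nth 0 vars j.
  exact: mon_mask2 size_vars.
have := (pairE 0 1 isT, pairE 0 2 isT, pairE 0 3 isT, pairE 1 2 isT, pairE 1 3 isT,
  pairE 2 3 isT)%N.
rewrite /mask2 /= => {}pairE.
have sumT (F : nat -> F2) : [/\
    \sum_(i <- iota 0 4 | nth false [:: false; true; true; true] i) F i = F 1%N + (F 2%N + F 3%N),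
    \sum_(i <- iota 0 4 | nth false [:: true; false; true; true] i) F i = F 0%N + (F 2%N + F 3%N),
    \sum_(i <- iota 0 4 | nth false [:: true; true; false; true] i) F i = F 0%N + (F 1%N + F 3%N)
  & \sum_(i <- iota 0 4 | nth false [:: true; true; true;
    false] i) F i = F 0%N + (F 1%N + F 2%N)].
  by split; rewrite unlock /= addr0.
move: T3; rewrite masks3 !inE.
pose F T i := L (mon vars (bits (set_nth false T i false)) * (nth 0 vars i * mon vars m) ^+ 2).
case/or4P => /eqP->; rewrite -/(F _).
- have [e _ _ _] := sumT (F [:: false; true; true; true]); rewrite [LHS]e /F.
  rewrite ![set_nth _ _ _ _]/= !pairE; exact: koszul.
- have [_ e _ _] := sumT (F [:: true; false; true; true]); rewrite [LHS]e /F.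
  rewrite ![set_nth _ _ _ _]/= !pairE; exact: koszul.
- have [_ _ e _] := sumT (F [:: true; true; false; true]); rewrite [LHS]e /F.
  rewrite ![set_nth _ _ _ _]/= !pairE; exact: koszul.
- have [_ _ _ e] := sumT (F [:: true; true; true; false]); rewrite [LHS]e /F.
  rewrite ![set_nth _ _ _ _]/= !pairE; exact: koszul.
Qed.

Lemma koszul_points_expos : {subset koszul_points <= expos 4 31}.
Proof.
have: all (fun m => (size m == 4%N) && (Nsum m == 31%num)) koszul_points by vm_compute.
by move/allP=> h m /h; rewrite mem_expos.
Qed.

Lemma pair_basis_mask x : x \in pair_basis -> x.1 \in masks 2 /\ x.2 \in expos 4 32.
Proof.
have: all (fun x => (x.1 \in masks 2) && ((size x.2 == 4%N) && (Nsum x.2 == 32%num))) pair_basis.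
  by vm_compute.
by move/allP=> h /h; rewrite mem_expos => /andP[].
Qed.

Lemma quad_basis_mask x : x \in quad_basis -> x.1 = nseq 4 true /\ x.2 \in expos 4 31.
Proof.
have: all (fun x => (x.1 == nseq 4 true) && ((size x.2 == 4%N) && (Nsum x.2 == 31%num))) quad_basis.
  by vm_compute.
by move/allP=> h /h; rewrite mem_expos => /andP[/eqP].
Qed.

Lemma nilp_normal_form phi t v : sound phi t -> nilp (normal_form t v) -> vec_val phi v = 0.
Proof.
by move=> st /nilP; rewrite -(vec_val_normal_form v st) => ->; rewrite /vec_val big_nil.
Qed.

Lemma slice_pair0 A e : {in pair_basis, forall x, slice x.1 (mon vars x.2) = 0} ->
  A \in masks 2 -> e \in expos 4 32 -> slice A (mon vars e) = 0.
Proof.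
move=> B0 A2 e32.
have st B : B \in masks 2 -> sound (coef_at (slice B) 32) (hit_table 32 hit_rows32).
  by move=> B2; apply: sound_hit_table => //; apply: slice_killing.
(* The tables are generalised together with their soundness, so that no later step evaluates
   them. *)
have := pair_coverT; rewrite /pair_cover; move: (hit_table 32 _) st => t st; cbv zeta.
have: sound pair_coef (koszul_table t).
  apply: sound_foldl => [s m m31 ss|]; last exact: sound_empty.
  apply: sound_foldl ss => u T T3 su; apply: (sound_insert su).
  exact: koszul_vec0 T3 (koszul_points_expos m31) st.
move: (koszul_table t) => s ss.
set s' := foldl _ _ _; have ss' : sound pair_coef s'.
  apply: sound_foldl ss => u x xB su; apply: (sound_insert su).
  have [A'2 e'32] := pair_basis_mask xB.
  rewrite -[[:: _]]/[seq label x.1 k | k <- [:: key x.2]] vec_val_label.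
    by rewrite (vec_val_key _ _ e'32) // B0.
  by apply/eqP; move: A'2; rewrite mem_filter => /andP[_ /size_bitseqs->].
move/allP/(_ _ e32)/allP/(_ _ A2)/(nilp_normal_form ss').
rewrite vec_val_label ?(vec_val_normal_form _ (st _ A2)) ?(vec_val_key _ _ e32) //.
by apply/eqP; move: A2; rewrite mem_filter => /andP[_ /size_bitseqs->].
Qed.

Lemma slice_quad0 M e : killing 31 M ->
  {in quad_basis, forall x, M (mon vars x.2) = 0} ->
  e \in expos 4 31 -> M (mon vars e) = 0.
Proof.
move=> kM B0 e31; have := quad_coverT; rewrite /quad_cover.
have := sound_hit_table (erefl : (0 < 31)%num) (erefl : (31 < 64)%num) kM (bs := hit_rows31).
move=> /(_ ltac:(by vm_compute)); move: (hit_table 31 _) => t st; cbv zeta.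
set t' := foldl _ _ _; have st' : sound (coef_at M 31) t'.
  apply: sound_foldl st => u x xB su; apply: (sound_insert su).
  by have [_ e'31] := quad_basis_mask xB; rewrite (vec_val_key _ _ e'31) // B0.
by move/allP/(_ _ e31)/(nilp_normal_form st'); rewrite (vec_val_key _ _ e31).
Qed.

End Slices.

(** * Vanishing in degree 66 *)

Section Vanishing.
Variable L : P4 -> F2.
Hypothesis kL : killing 66 L.

Lemma mem_mask2 i j : (i < j < 4)%N -> mask2 i j \in masks 2.
Proof. by case: i j => [|[|[|[|i]]]] [|[|[|[|j]]]] // ij; lia. Qed.

Lemma F2_cases (c : F2) : c = 0 \/ c = 1.
Proof. by case: c => [[|[|]]] // i; [left|right]; apply: val_inj. Qed.

(** Extends the vanishing from increasing pairs and monomials to the form that [killing_quad]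
    requires. For i = j the argument is the square of t_i q, which is Sq^33 of it. *)
Lemma pair_eq0 (i j : 'I_4) q :
    (forall A e, A \in masks 2 -> e \in expos 4 32 -> slice L A (mon vars e) = 0) ->
  q \is 32.-homog -> L ('X_i * 'X_j * q ^+ 2) = 0.
Proof.
move=> L0; have kij := @killing_pair 32 L i j kL.
move: q; apply: (@dhomog_ind _ _ (fun q => L ('X_i * 'X_j * q ^+ 2) = 0)).
  exact: (killing0 kij).
move=> c a q da IHq; have := kij.1 (c *: 'X_[a]) q; rewrite IHq addr0 => ->.
case: (F2_cases c) => ->; first by rewrite scale0r; exact: (killing0 kij).
rewrite scale1r; wlog le_ij: i j kij IHq / (i <= j)%N => [hw|].
  case: (leqP i j) => [|/ltnW] ij; first exact: hw.
  rewrite ['X_i * _]mulrC; apply: hw ij; first exact: (@killing_pair 32 L j i kL).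
  by rewrite ['X_j * _]mulrC.
have aE : 'X_[a] = mon vars (expo_of a) by rewrite mon_vars ?size_expo_of ?expo_ofK.
have a32 : expo_of a \in expos 4 32.
  rewrite mem_expos size_expo_of /=; apply/eqP.
  have := mdeg_mnm_of (size_expo_of a); rewrite expo_ofK da; lia.
case: (eqVneq i j) => [<-|ne_ij].
  rewrite -expr2 -exprMn; apply: (@killing_sqr 33) => //.
  by apply: (dhomogM (dhomogX1 i)); rewrite dhomogX /= da.
have ltij : (i < j < 4)%N by rewrite ltn_neqAle ne_ij le_ij ltn_ord.
have := L0 (mask2 i j) _ _ a32; rewrite /slice mon_mask2 ?size_vars // -aE.
rewrite !nth_vars ?ltn_ord // !inord_val; apply.
exact: mem_mask2.
Qed.

(** As 66 is even, a monomial has 0, 2 or 4 odd exponents: it is a square, killed by Sq^33, or a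
    value of a pair slice in degree 32, or of the quadruple slice in degree 31. *)
Lemma killing66_eq0 : {in basis66, forall e, L (mon vars e) = 0} ->
  {in expos 4 66, forall e, L (mon vars e) = 0}.
Proof.
move=> B0.
have sliceE A e : size A = size e -> L (mon vars (double_plus A e)) = slice L A (mon vars e).
  by move=> sAe; rewrite mon_double_plus.
have basisE : basis66 = [seq double_plus x.1 x.2 | x <- pair_basis ++ quad_basis].
  by vm_cast_no_check (erefl basis66).
have slice0 x : x \in pair_basis ++ quad_basis -> size x.1 = size x.2 ->
    slice L x.1 (mon vars x.2) = 0.
  by move=> xB sx; rewrite -sliceE //; apply: B0; rewrite basisE; apply/mapP; exists x.
have pair0 A e : A \in masks 2 -> e \in expos 4 32 -> slice L A (mon vars e) = 0.
  move=> A2 e32; apply: (slice_pair0 kL _ A2 e32) => x xB; apply: slice0;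
    first by rewrite mem_cat xB.
  have [] := pair_basis_mask xB; rewrite mem_filter mem_expos.
  by move=> /andP[_ /size_bitseqs ->] /andP[/eqP->].
have [i0 [i1 [i2 [i3 quadE]]]] : exists i0 i1 i2 i3 : 'I_4,
    mon vars (bits (nseq 4 true)) = 'X_i0 * 'X_i1 * ('X_i2 * 'X_i3).
  rewrite /vars !enum_ordSl enum_ord0 /= !expr1 mulr1.
  by do 4!eexists; rewrite mulrA.
have quad0 e : e \in expos 4 31 -> slice L (nseq 4 true) (mon vars e) = 0.
  have kM : killing 31 (slice L (nseq 4 true)).
    rewrite /slice quadE; apply: (@killing_quad 31 L i0 i1 i2 i3 kL) => i j q.
    exact: pair_eq0 pair0.
  apply: (slice_quad0 kM) => x xB.
  have [x1 x2] := quad_basis_mask xB; rewrite -x1; apply: slice0.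
    by rewrite mem_cat xB orbT.
  by move: x2; rewrite x1 mem_expos => /andP[/eqP->].
move=> e; rewrite mem_expos => /andP[].
case: e => [|a [|b [|c [|d []]]]] //= _ /eqP s66.
pose A := [seq N.odd x | x <- [:: a; b; c; d]]; pose f := [seq N.div2 x | x <- [:: a; b; c; d]].
have -> : [:: a; b; c; d] = double_plus A f.
  have half x : (if N.odd x then N.succ_double (N.div2 x) else N.double (N.div2 x)) = x.
    by case: x => [|[]].
  by rewrite /double_plus /= !half.
rewrite sliceE //.
have sumE : (N.of_nat (count id A) + (Nsum f + Nsum f) = 66)%num.
  have half x : x = (N.div2 x + N.div2 x + N.of_nat (N.odd x))%num.
    by case: x => [|[p|p|]] //=; lia.
  have -> : N.of_nat (count id A) = (N.of_nat (N.odd a) + N.of_nat (N.odd b) +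
      N.of_nat (N.odd c) + N.of_nat (N.odd d))%num by rewrite /A /=; lia.
  rewrite /f [Nsum _]/=; move: (half a) (half b) (half c) (half d); lia.
have Af : (count id A <= 4)%N by apply: (count_size id A).
have A_masks : A \in masks (count id A).
  by rewrite mem_filter eqxx /A /=; case: (N.odd a) (N.odd b) (N.odd c) (N.odd d) => [] [] [] [].
case: (count id A) Af A_masks sumE => [|[|[|[|[|]]]]] // _; try (by lia).
- have -> : masks 0 = [:: nseq 4 false] by [].
  rewrite inE => /eqP-> sf; rewrite /slice.
  have -> : mon vars (bits (nseq 4 false)) = 1.
    by rewrite /vars !enum_ordSl enum_ord0 /= !expr0 !mul1r.
  have f33 : Nsum f = 33%num by move: (Nsum f) sf => s; lia.
  by rewrite mul1r; apply: (@killing_sqr 33) => //;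
    rewrite mon_vars // dhomogX /= mdeg_mnm_of // f33.
- move=> A2 sf; apply: pair0 => //; rewrite mem_expos.
  by apply/andP; split=> //; apply/eqP; move: (Nsum f) sf => s; lia.
- have -> : masks 4 = [:: nseq 4 true] by [].
  rewrite inE => /eqP-> sf; apply: quad0; rewrite mem_expos.
  by apply/andP; split=> //; apply/eqP; move: (Nsum f) sf => s; lia.
Qed.

End Vanishing.

(** * Coefficients of products of linear forms *)

(* The i-th item of [cols] lists the coefficients of a linear form l_i, and
   [coef] is the coefficient of t^c in the product of the l_i^a_i: this product is
   that of the l_i with a_i odd, expanded by [pick_coef], times the square of the
   product of the l_i^(a_i / 2). *)
Definition branches (col : bitseq) (c : seq N) : seq (seq N) :=
  [seq set_nth 0%num c j (N.pred (nth 0%num c j)) |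
    j <- iota 0 4 & nth false col j && (nth 0%num c j != 0%num)].

Fixpoint pick_coef (cols : seq bitseq) (cont : seq N -> bool) (c : seq N) : bool :=
  if cols is col :: cols' then
    foldr (fun c' b => pick_coef cols' cont c' (+) b) false (branches col c)
  else cont c.

Fixpoint coef (fuel : nat) (cols : seq bitseq) (a c : seq N) : bool :=
  if fuel is fuel'.+1 then
    pick_coef (mask [seq N.odd x | x <- a] cols)
      (fun c' => if has N.odd c' then false else
        coef fuel' cols [seq N.div2 x | x <- a] [seq N.div2 x | x <- c']) c
  else all (eq_op 0%num) c.

Definition form (v : 'rV[F2]_4) : P4 := \sum_j v 0 j *: 'X_j.

(* Only the coefficients of the t_j with c_j <> 0 have to be known: for the dual of
   t_1^63 t_2^3 this leaves two rows of a matrix. *)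
Definition compat (z : seq (bitseq * 'rV[F2]_4)) (c : seq N) :=
  forall x (j : 'I_4), x \in z -> nth 0%num c j != 0%num -> x.2 0 j = (nth false x.1 j)%:R.

Lemma natr_addb (a b : bool) : ((a (+) b)%:R : F2) = a%:R + b%:R.
Proof. by case: a b => [] []; rewrite ?addF2 ?addr0 ?add0r. Qed.

Lemma mcoeff_XM (j : 'I_4) (q : P4) k :
  ('X_j * q)@_k = if (0 < k j)%N then q@_(k - U_(j))%MM else 0.
Proof.
case: ifP => k0.
  have {1}-> : k = (U_(j) + (k - U_(j)))%MM.
    apply/mnmP => i; rewrite mnmDE mnmBE mnm1E; case: eqP => [<-|_]; lia.
  by rewrite mulrC mcoeffMX.
rewrite mcoeffM big1 // => -[k1 k2] /= /eqP kE; rewrite mcoeffX.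
case: eqP => [jk1|_]; last by rewrite mul0r.
by have := congr1 (fun m : 'X_{1..4} => m j) kE; rewrite mnmDE -jk1 mnm1E eqxx; lia.
Qed.

Lemma mnm_of_pred j c : (j < 4)%N -> size c = 4%N -> nth 0%num c j != 0%num ->
  mnm_of (set_nth 0%num c j (N.pred (nth 0%num c j))) = (mnm_of c - U_(inord j))%MM.
Proof.
move=> j4 sc c0; apply/mnmP => i; rewrite mnmBE !mnmE nth_set_nth /=.
have -> : (inord j == i) = (i == j :> nat) by rewrite -val_eqE /= inordK // eq_sym.
by case: eqP => [->|_]; lia.
Qed.

Lemma form_coef x c (q : P4) : size c = 4%N -> compat [:: x] c ->
  (form x.2 * q)@_(mnm_of c) = \sum_(c' <- branches x.1 c) q@_(mnm_of c').
Proof.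
move=> sc xc; rewrite /form mulr_suml linear_sum /= big_map big_filter.
rewrite -[iota 0 4]/(index_iota 0 4) big_mkord [RHS]big_mkcond /=.
apply: eq_bigr => j _; rewrite -scalerAl mcoeffZ mcoeff_XM mnmE.
have [c0|c0] := eqVneq (nth 0%num c j) 0%num.
  by rewrite c0 mulr0 andbF.
rewrite ifT; last by lia.
rewrite (xc x) ?mem_head // andbT mnm_of_pred // inord_val.
by case: (nth _ _ _); rewrite ?mul1r ?mul0r.
Qed.

(** Exponents only decrease in the recursion, so their support stays inside that of [c]; the
    condition on [c'] records this, and it is what hands [compat] on to the next halving. *)
Lemma pick_coefE z (cont : seq N -> bool) c (q : P4) : size c = 4%N -> compat z c ->
    (forall c', size c' = 4%N -> (forall j, nth 0%num c' j != 0%num -> nth 0%num c j != 0%num) ->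
      q@_(mnm_of c') = (cont c')%:R) ->
  ((\prod_(x <- z) form x.2) * q)@_(mnm_of c) = (pick_coef (unzip1 z) cont c)%:R.
Proof.
elim: z c => [|x z IHz] c sc zc qc.
  by rewrite big_nil mul1r qc.
rewrite big_cons -mulrA form_coef //; last first.
  by move=> y j; rewrite inE => /eqP->; apply: zc; rewrite mem_head.
rewrite [unzip1 _]/=.
rewrite -[pick_coef _ _ _]/(foldr (fun c' b =>
  pick_coef (unzip1 z) cont c' (+) b) false (branches x.1 c)).
have: {subset branches x.1 c <= branches x.1 c} by [].
elim: {1 3 4}(branches x.1 c) => [|c' s IHs] sub; first by rewrite big_nil.
rewrite big_cons [foldr _ _ _]/= natr_addb IHs => [|d ds]; last first.
  by apply: sub; rewrite inE ds orbT.
congr (_ + _).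
have /mapP[j] := sub _ (mem_head _ _).
rewrite mem_filter mem_iota => /andP[/andP[_ cj] /= j4] ->.
have le i : nth 0%num (set_nth 0%num c j (N.pred (nth 0%num c j))) i != 0%num ->
    nth 0%num c i != 0%num.
  by rewrite nth_set_nth /=; case: (eqVneq i j) => [-> _|].
apply: IHz => [|y i yz /le|d sd hd].
- by rewrite size_set_nth sc; lia.
- by apply: zc; rewrite inE yz orbT.
- by apply: qc => // i /hd/le.
Qed.

Lemma mcoeff_sqr (p : P4) c : size c = 4%N ->
  (p ^+ 2)@_(mnm_of c) =
  if has N.odd c then 0 else p@_(mnm_of [seq N.div2 x | x <- c]).
Proof.
move=> sc; elim/mpolyind: p => [|a m p _ _ IHp].
  by rewrite expr0n !mcoeff0 if_same.
rewrite sqrrD_F2 !mcoeffD IHp exprZn mpolyXn !mcoeffZ !mcoeffX F2_idem.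
have half x : x = (N.div2 x + N.div2 x + N.of_nat (N.odd x))%num.
  by case: x => [|[q|q|]] //=; lia.
case: ifP => [/hasP[x xc ox]|/hasPn ev].
  rewrite addr0; case: eqP => [mE|_]; last by rewrite mulr0.
  have /(nthP 0%num)[i ic xE] := xc; rewrite sc in ic.
  have := congr1 (fun m : 'X_{1..4} => m (inord i)) mE.
  by rewrite mulmnE mnmE inordK // xE => h; have := half x; rewrite ox; lia.
have evn (i : 'I_4) : ~~ N.odd (nth 0%num c i) by apply/ev/mem_nth; rewrite sc.
congr (_ * _%:R + _); congr (nat_of_bool _); apply/eqP/eqP => [mE|->].
  apply/mnmP => i; have := congr1 (fun m : 'X_{1..4} => m i) mE.
  rewrite mulmnE !mnmE (nth_map 0%num) ?sc //; have := half (nth 0%num c i).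
  by rewrite (negPf (evn i)) /=; lia.
apply/mnmP => i; rewrite mulmnE !mnmE (nth_map 0%num) ?sc //.
have := half (nth 0%num c i).
by rewrite (negPf (evn i)) /=; lia.
Qed.

Lemma mon_bits (R : comNzRingType) (ys : seq R) A : size A = size ys ->
  mon ys (bits A) = \prod_(y <- mask A ys) y.
Proof.
elim: A ys => [|s A IHA] [|y ys] //=; rewrite ?big_nil // => -[/IHA ->].
by case: s; rewrite /= ?big_cons ?expr1 ?mul1r.
Qed.

Lemma coefE fuel z a c : size z = 4%N -> size a = 4%N -> size c = 4%N ->
    all (fun x => N.ltb x (2 ^ N.of_nat fuel)) a -> compat z c ->
  (mon [seq form x.2 | x <- z] a)@_(mnm_of c) = (coef fuel (unzip1 z) a c)%:R.
Proof.
elim: fuel z a c => [|fuel IHf] z a c sz sa sc a_lt zc.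
  have -> : mon [seq form x.2 | x <- z] a = 1.
    elim: z a a_lt {sz sa zc} => [|x z IHz] [|y a] //= /andP[y0 /IHz->].
    by rewrite (_ : y = 0%num) ?expr0 ?mul1r //; lia.
  rewrite mcoeff1 /=; congr (_%:R); congr nat_of_bool.
  case: c sc {zc} => [|c0 [|c1 [|c2 [|c3 []]]]] // _.
  apply/eqP/and5P => [/mnmP cE|[/eqP<- /eqP<- /eqP<- /eqP<- _]].
    have := (cE (inord 0), cE (inord 1), cE (inord 2), cE (inord 3)).
    rewrite !mnmE ?mnm0E !inordK //= => -[[[]]] *; split=> //; lia.
  by apply/mnmP => i; rewrite mnmE ?mnm0E ?mnmE; case: i => [[|[|[|[|]]]]].
set A := [seq N.odd x | x <- a]; set f := [seq N.div2 x | x <- a].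
have aE : a = double_plus A f.
  have half x : (if N.odd x then N.succ_double (N.div2 x) else N.double (N.div2 x)) = x.
    by case: x => [|[]].
  rewrite /double_plus /A /f zip_map -map_comp -[LHS]map_id.
  by apply: eq_map => x /=; rewrite half.
rewrite [X in mon _ X]aE mon_double_plus ?size_map ?sz // mon_bits ?size_map ?sz //.
rewrite -map_mask big_map /=.
rewrite -[mask _ (unzip1 z)]map_mask; apply: pick_coefE => // [x j /mem_mask|c' sc' hc'].
  exact: zc.
rewrite mcoeff_sqr //; case: ifP => // _; apply: IHf; rewrite ?size_map //.
- rewrite all_map; apply: sub_all a_lt => x; rewrite /preim.
  rewrite Nnat.Nat2N.inj_succ N.pow_succ_r'; move: (2 ^ _)%num => y; cbv beta.
  by move/N.ltb_spec0 => xy; apply/N.ltb_spec0; rewrite N.div2_div;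
    apply: N.Div0.div_lt_upper_bound.
- move=> x j xz; rewrite (nth_map 0%num) ?sc' // => h; apply: zc => //; apply: hc'.
  by case: (nth _ _ _) h.
Qed.

(** * Annihilated elements, group elements and the invariant form *)

(** All exponents have the form 2^s - 1. No positive square of a power of t reaches t^(2^s - 1), so
    by the Cartan formula the dual of such a monomial is annihilated; 31, 31, 3, 1 and 1, 1, 1, 63
    are of the same kind. *)
Definition flag_dual : seq (seq N) := [:: [:: 63; 3; 0; 0]]%num.

Definition spike_dual : seq (seq N) := [:: [:: 31; 31; 3; 1]]%num.

(* The lift, by Kameko's map, of an annihilated element of degree 31. *)
Definition kameko_dual : seq (seq N) :=
  [seq [seq N.succ_double x | x <- c] | c <- [::
   [:: 3; 1; 13; 14]; [:: 3; 2; 13; 13]; [:: 3; 4; 13; 11]; [:: 3; 5; 14; 9]; [:: 3; 6; 13; 9];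
   [:: 3; 8; 13; 7]; [:: 3; 9; 14; 5]; [:: 3; 10; 13; 5]; [:: 3; 12; 13; 3]; [:: 5; 1; 11; 14];
   [:: 5; 2; 11; 13]; [:: 5; 3; 14; 9]; [:: 5; 4; 11; 11]; [:: 5; 6; 11; 9]; [:: 5; 8; 11; 7];
   [:: 5; 9; 14; 3]; [:: 5; 10; 11; 5]; [:: 5; 12; 11; 3]; [:: 6; 3; 13; 9]; [:: 6; 5; 11; 9];
   [:: 6; 9; 11; 5]; [:: 6; 9; 13; 3]; [:: 7; 1; 9; 14]; [:: 7; 1; 10; 13]; [:: 7; 1; 12; 11];
   [:: 7; 8; 7; 9]; [:: 7; 8; 11; 5]; [:: 7; 8; 13; 3]; [:: 9; 1; 7; 14]; [:: 9; 2; 7; 13];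
   [:: 9; 3; 14; 5]; [:: 9; 4; 7; 11]; [:: 9; 5; 14; 3]; [:: 9; 6; 7; 9]; [:: 9; 8; 7; 7];
   [:: 9; 10; 7; 5]; [:: 9; 12; 7; 3]; [:: 10; 3; 13; 5]; [:: 10; 5; 7; 9]; [:: 10; 5; 13; 3];
   [:: 10; 9; 7; 5]; [:: 11; 1; 5; 14]; [:: 11; 1; 6; 13]; [:: 11; 1; 12; 7]; [:: 11; 4; 7; 9];
   [:: 11; 4; 11; 5]; [:: 11; 4; 13; 3]; [:: 12; 3; 7; 9]; [:: 12; 3; 11; 5];
   [:: 12; 5; 11; 3]; [:: 12; 9; 7; 3]; [:: 13; 1; 3; 14]; [:: 13; 1; 6; 11];
   [:: 13; 1; 10; 7]; [:: 13; 2; 7; 9]; [:: 13; 2; 11; 5]; [:: 13; 2; 13; 3];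
   [:: 14; 1; 3; 13]; [:: 14; 1; 5; 11]; [:: 14; 1; 7; 9]; [:: 14; 1; 9; 7]; [:: 14; 1; 11; 5];
   [:: 14; 1; 13; 3]; [:: 5; 5; 14; 7]; [:: 5; 7; 14; 5]; [:: 6; 5; 13; 7]; [:: 6; 7; 13; 5];
   [:: 7; 4; 7; 13]; [:: 7; 5; 14; 5]; [:: 7; 6; 13; 5]; [:: 7; 12; 7; 5]; [:: 12; 5; 7; 7];
   [:: 12; 7; 7; 5]; [:: 13; 4; 7; 7]; [:: 3; 3; 14; 11]; [:: 3; 11; 14; 3]; [:: 6; 3; 11; 11];
   [:: 6; 11; 11; 3]; [:: 7; 2; 11; 11]; [:: 10; 3; 7; 11]; [:: 10; 11; 7; 3];
   [:: 11; 2; 11; 7]; [:: 11; 3; 14; 3]; [:: 11; 6; 11; 3]; [:: 11; 10; 7; 3];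
   [:: 3; 7; 14; 7]; [:: 6; 7; 11; 7]; [:: 7; 3; 7; 14]; [:: 7; 7; 7; 10]; [:: 7; 7; 11; 6];
   [:: 7; 7; 14; 3]; [:: 7; 11; 7; 6]; [:: 10; 7; 7; 7]; [:: 11; 6; 7; 7]; [:: 11; 7; 7; 6];
   [:: 14; 3; 7; 7]]%num].

(* Bit 4 * j + i of a code is the entry (j, i) of g^-1; the codes were selected by
   elimination among all g. *)
Definition flag_moves : seq N := [::
   0x8241; 0x8261; 0x4281; 0x42a1; 0x42c1; 0x42e1; 0x8412; 0x8142; 0x8152; 0x4182; 0x4192;
   0x41c2; 0x41d2; 0x8413; 0x8143; 0x8153; 0x4183; 0x4193; 0x41c3; 0x41d3; 0x8214; 0x8124;
   0x8134; 0x2184; 0x2194; 0x21a4; 0x21b4; 0x8215; 0x8125; 0x8135; 0x2185; 0x2195; 0x21a5;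
   0x21b5; 0x8216; 0x8126; 0x8136; 0x2186; 0x2196; 0x21a6; 0x21b6; 0x8217; 0x8127; 0x8137;
   0x2187; 0x2197; 0x21a7; 0x21b7; 0x4218; 0x4128; 0x4138; 0x2148; 0x2158; 0x2168; 0x2178;
   0x4219; 0x4129; 0x4139; 0x2149; 0x2159; 0x2169; 0x2179; 0x421a; 0x412a; 0x413a; 0x214a;
   0x215a; 0x216a; 0x217a; 0x421b; 0x412b; 0x413b; 0x214b; 0x215b; 0x216b; 0x217b; 0x421c;
   0x412c; 0x413c; 0x214c; 0x215c; 0x216c; 0x217c; 0x421d; 0x412d; 0x413d; 0x214d; 0x215d;
   0x216d; 0x217d; 0x421e; 0x412e; 0x413e; 0x214e; 0x215e; 0x216e; 0x217e; 0x421f; 0x412f;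
   0x413f; 0x214f; 0x215f; 0x216f; 0x217f]%num.

Definition spike_moves : seq N := [::
   0x4821; 0x4c21; 0x8241; 0x2841; 0x8261; 0x2861; 0x4281; 0x2481; 0x42a1; 0x24a1; 0x42c1;
   0x24c1; 0x42e1; 0x24e1; 0x8142; 0x1842; 0x8152; 0x1852; 0x4182; 0x1482; 0x4192; 0x1492;
   0x41c2; 0x14c2; 0x41d2; 0x14d2; 0x8143; 0x1843; 0x8153; 0x1853; 0x4183; 0x1483; 0x4193;
   0x1493; 0x41c3; 0x14c3; 0x41d3; 0x14d3; 0x2184; 0x1284; 0x2194; 0x1294; 0x21a4; 0x12a4;
   0x21b4; 0x12b4; 0x2185; 0x1285; 0x2195; 0x1295; 0x21a5; 0x12a5; 0x21b5; 0x12b5; 0x2186;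
   0x1286; 0x2196; 0x1296; 0x21a6; 0x12a6; 0x21b6; 0x12b6; 0x2187; 0x1287; 0x2197; 0x1297;
   0x21a7; 0x12a7; 0x21b7; 0x12b7]%num.

Definition kameko_moves : seq N := [:: 0x8423; 0x8621; 0xa421; 0x8241]%num.

Definition moves : seq (seq (seq N) * N) :=
  [seq (flag_dual, h) | h <- flag_moves] ++ [seq (spike_dual, h) | h <- spike_moves] ++
  [seq (kameko_dual, h) | h <- kameko_moves].

(* Found by solving lambda (g z) = lambda z for the sum lambda of unknown
   coordinates. *)
Definition invariant_expos : seq (seq N) := [::
   [:: 0; 0; 3; 63]; [:: 0; 0; 7; 59]; [:: 0; 0; 63; 3]; [:: 0; 1; 2; 63]; [:: 0; 1; 6; 59];
   [:: 0; 1; 7; 58]; [:: 0; 1; 62; 3]; [:: 0; 1; 63; 2]; [:: 0; 3; 0; 63]; [:: 0; 3; 3; 60];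
   [:: 0; 3; 5; 58]; [:: 0; 3; 61; 2]; [:: 0; 3; 63; 0]; [:: 0; 7; 0; 59]; [:: 0; 7; 1; 58];
   [:: 0; 7; 59; 0]; [:: 0; 63; 0; 3]; [:: 0; 63; 1; 2]; [:: 0; 63; 3; 0]; [:: 1; 0; 2; 63];
   [:: 1; 0; 6; 59]; [:: 1; 0; 7; 58]; [:: 1; 0; 62; 3]; [:: 1; 0; 63; 2]; [:: 1; 1; 2; 62];
   [:: 1; 1; 62; 2]; [:: 1; 2; 0; 63]; [:: 1; 2; 4; 59]; [:: 1; 2; 5; 58]; [:: 1; 2; 7; 56];
   [:: 1; 2; 60; 3]; [:: 1; 2; 61; 2]; [:: 1; 2; 63; 0]; [:: 1; 3; 2; 60]; [:: 1; 6; 0; 59];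
   [:: 1; 6; 1; 58]; [:: 1; 6; 59; 0]; [:: 1; 7; 0; 58]; [:: 1; 7; 2; 56]; [:: 1; 7; 58; 0];
   [:: 1; 62; 0; 3]; [:: 1; 62; 1; 2]; [:: 1; 62; 3; 0]; [:: 1; 63; 0; 2]; [:: 1; 63; 2; 0];
   [:: 3; 0; 0; 63]; [:: 3; 0; 3; 60]; [:: 3; 0; 5; 58]; [:: 3; 0; 61; 2]; [:: 3; 0; 63; 0];
   [:: 3; 1; 2; 60]; [:: 3; 3; 0; 60]; [:: 3; 3; 4; 56]; [:: 3; 3; 60; 0]; [:: 3; 5; 0; 58];
   [:: 3; 5; 58; 0]; [:: 3; 61; 0; 2]; [:: 3; 61; 2; 0]; [:: 3; 63; 0; 0]; [:: 7; 0; 0; 59];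
   [:: 7; 0; 1; 58]; [:: 7; 0; 59; 0]; [:: 7; 1; 0; 58]; [:: 7; 1; 2; 56]; [:: 7; 1; 58; 0];
   [:: 7; 59; 0; 0]; [:: 63; 0; 0; 3]; [:: 63; 0; 1; 2]; [:: 63; 0; 3; 0]; [:: 63; 1; 0; 2];
   [:: 63; 1; 2; 0]; [:: 63; 3; 0; 0]; [:: 1; 1; 1; 63]; [:: 1; 1; 3; 61]; [:: 1; 1; 63; 1];
   [:: 1; 3; 1; 61]; [:: 1; 3; 5; 57]; [:: 1; 3; 61; 1]; [:: 1; 63; 1; 1]; [:: 3; 1; 1; 61];
   [:: 3; 1; 5; 57]; [:: 3; 1; 61; 1]; [:: 3; 5; 1; 57]; [:: 3; 5; 9; 49]; [:: 3; 5; 57; 1];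
   [:: 3; 61; 1; 1]; [:: 63; 1; 1; 1]]%num.

(** * Certificates for rank, invariance and annihilation *)

Definition columns (h : N) : seq bitseq :=
  [seq [seq N.testbit h (N.of_nat (4 * j + i)) | j <- iota 0 4] | i <- iota 0 4].

Definition dual_coef (cs : seq (seq N)) (cols : seq bitseq) (a : seq N) : bool :=
  foldr (fun c b => coef 7 cols a c (+) b) false cs.

Definition move_val (x : seq (seq N) * N) (a : seq N) : bool :=
  dual_coef x.1 (columns x.2) a (+) odd (count_mem a x.1).

Definition row_step (r : seq N -> bool) k (v : seq positive) : seq positive :=
  if r (nth [::] basis66 k) then vec_add [:: Pos.of_succ_nat k] v else v.

Definition row_vec r : seq positive := foldr (row_step r) [::] (iota 0 (size basis66)).

(** Each row is read as a relation among unknowns indexed by [basis66]; that all unknowns then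
    reduce to the empty vector means that the rows span the whole coordinate space. *)
Definition rank_check : bool :=
  let t := foldl (fun t x => insert t (row_vec (move_val x)))
    (insert (PositiveMap.empty _) (row_vec (fun a => odd (count_mem a flag_dual)))) moves in
  all (fun k => nilp (normal_form t [:: Pos.of_succ_nat k])) (iota 0 (size basis66)).

Lemma rank_checkT : rank_check.
Proof. by vm_cast_no_check (erefl true). Qed.

(* Every row of the identity matrix is x * h for some row vector x. *)
Definition unit_code (h : N) : bool :=
  all (fun i => has (fun x => all (fun k =>
      odd (count (fun j =>
          N.testbit x (N.of_nat j) && N.testbit h (N.of_nat (4 * j + k))) (iota 0 4))
        == (i == k)) (iota 0 4)) (Nupto 15)) (iota 0 4).

Lemma moves_unit : all (fun x => unit_code x.2) moves.
Proof. by vm_cast_no_check (erefl true). Qed.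

Definition nonzero_rows : seq bitseq := [seq v <- bitseqs 4 | has id v].

(** Columns cut down to the coefficients of t_1 and t_2, the only variables in t_1^63 t_2^3. *)
Definition flag_columns (v w : bitseq) : seq bitseq := [seq [:: x.1; x.2] | x <- zip v w].

(** Over F_2, two nonzero rows are independent exactly when they differ, so these are all the
    possible first two rows of an invertible matrix. *)
Definition flag_check : bool :=
  all (fun v => all (fun w => (v == w) ||
      foldr (fun a b => dual_coef flag_dual (flag_columns v w) a (+) b) false invariant_expos)
    nonzero_rows) nonzero_rows.

Lemma flag_checkT : flag_check.
Proof. by vm_cast_no_check (erefl true). Qed.

(* The multiplicity of t^c in the total square of t^b. *)
Fixpoint sq_count (b c : seq N) : nat :=
  match b, c with
  | x :: b', y :: c' =>
    let m := count_mem y (sq_exps x) in if m is 0 then 0 else (m * sq_count b' c')%N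
  | _, _ => 1
  end.

Fixpoint sq_preds (c : seq N) : seq (seq N) :=
  if c is y :: c' then
    flatten [seq [seq x :: b | b <- sq_preds c'] | x <- Nupto y & y \in sq_exps x]
  else [:: [::]].

(** Only a t^b whose total square meets some t^c can give a nonzero value. The degree of [b] decides
    which square is involved; degree 66 means Sq^0 and is exempt. *)
Definition ann_check (cs : seq (seq N)) : bool :=
  all (fun c => (size c == 4%N) && (Nsum c == 66%num)) cs &&
  all (fun b => (Nsum b == 66%num) || ~~ odd (sumn [seq sq_count b c | c <- cs]))
    (flatten [seq sq_preds c | c <- cs]).

Lemma ann_checkT : all ann_check [:: flag_dual; spike_dual; kameko_dual; [:: [:: 1; 1; 1;
  63]%num]].
Proof. by vm_cast_no_check (erefl true). Qed.

(** * Homology classes as functionals on monomials *)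

Notation H66 := (homology 3 66).

Definition eval (f : H66) (p : P4) : F2 := f (homog_part 66 p).

Lemma evalD f : {morph eval f : p q / p + q}.
Proof. by move=> p q; rewrite /eval linearD linearD. Qed.

Lemma killing_Ann f : f \in Ann 3 66 -> killing 66 (eval f).
Proof.
move/AnnP/annihilatedP=> hf; split=> [|d k p hp dk k0]; first exact: evalD.
exact: (hf d k (DHomog hp)).
Qed.

Lemma mon_homog e : e \in expos 4 66 -> mon vars e \is 66.-homog.
Proof.
by rewrite mem_expos => /andP[/eqP se /eqP ne]; rewrite mon_vars // dhomogX /= mdeg_mnm_of // ne.
Qed.

Lemma expo_of_mem d a : mdeg a = N.to_nat d -> expo_of a \in expos 4 d.
Proof.
move=> da; rewrite mem_expos size_expo_of /=; apply/eqP.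
by have := mdeg_mnm_of (size_expo_of a); rewrite expo_ofK da; lia.
Qed.

Lemma mon_expo_of a : mon vars (expo_of a) = 'X_[a].
Proof. by rewrite mon_vars ?size_expo_of ?expo_ofK. Qed.

Lemma eval_eq0 f : {in expos 4 66, forall e, eval f (mon vars e) = 0} -> f = 0.
Proof.
move=> f0; apply/lfunP => p; rewrite lfunE /= -[p]homog_part_id.
have := dhomog_is_dhomog p; move: (val p).
apply: (@dhomog_ind _ _ (fun q => eval f q = 0)); first by rewrite /eval !linear0.
move=> c a q da IHq; rewrite evalD IHq addr0 /eval linearZ linearZ /=.
rewrite -mon_expo_of [f _](f0 _ _) ?scaler0 //.
exact: (@expo_of_mem 66).
Qed.

Definition dual (cs : seq (seq N)) : H66 := \sum_(c <- cs) dual_monomial 66 (mnm_of c).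

Lemma eval_dual cs q : q \is 66.-homog -> eval (dual cs) q = \sum_(c <- cs) q@_(mnm_of c).
Proof.
move=> hq; rewrite /eval /dual sum_lfunE; apply: eq_bigr => c _.
by rewrite dual_monomialE /= pihomog_dE.
Qed.

Lemma mnm_of_inj a c : size a = 4%N -> size c = 4%N -> (mnm_of a == mnm_of c) = (a == c).
Proof.
move=> sa sc; apply/eqP/eqP => [/mnmP ac|-> //].
apply: (@eq_from_nth _ 0%num) => [|i]; first by rewrite sa sc.
by rewrite sa => i4; have := ac (Ordinal i4); rewrite !mnmE /=; lia.
Qed.

Lemma sum_natr (T : Type) (s : seq T) (F : T -> nat) :
  \sum_(x <- s) (F x)%:R = (sumn [seq F x | x <- s])%:R :> F2.
Proof. by elim: s => [|x s IHs]; rewrite ?big_nil // big_cons IHs /= natrD. Qed.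

Lemma natr_odd (n : nat) : n%:R = (odd n)%:R :> F2.
Proof. by rewrite -{1}[n]odd_double_half natrD -addnn natrD addF2 addr0. Qed.

Lemma eval_dual_mon cs a : all (fun c => size c == 4%N) cs -> a \in expos 4 66 ->
  eval (dual cs) (mon vars a) = (odd (count_mem a cs))%:R.
Proof.
move=> scs ha; rewrite (eval_dual _ (mon_homog ha)); move: ha;
  rewrite mem_expos => /andP[/eqP sa _].
rewrite mon_vars // -natr_odd -sumn_count -sum_natr big_seq [RHS]big_seq; apply: eq_bigr => c ccs.
by rewrite mcoeffX mnm_of_inj ?(eqP (allP scs _ ccs)) // eq_sym.
Qed.

Lemma count_sq_terms b c n : size b = size c -> Nsum c = n ->
  count_mem c (sq_terms b n) = sq_count b c.
Proof.
elim: b c n => [|x b IHb] [|y c] n //=; first by move=> _ <-.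
move=> [sbc] cn; rewrite count_flatten -map_comp.
transitivity (count_mem y (sq_exps x) * sq_count b c)%N; last by case: (count_mem _ _).
elim: (sq_exps x) => //= e s ->; rewrite mulnDl; congr (_ + _)%N.
case: (eqVneq e y) => [->|ne]; last first.
  rewrite mul0n; case: ifP => // _; apply/eqP; rewrite -leqn0 leqNgt -has_count.
  by apply/hasPn => d /mapP[d' _ ->] /=; rewrite eqseq_cons (negPf ne).
have IH := IHb c (n - y)%num sbc ltac:(lia).
rewrite mul1n -IH; case: ifP => [_|gt]; last by rewrite sq_terms_lt //; lia.
by rewrite count_map; apply: eq_count => d /=; rewrite eqseq_cons eqxx.
Qed.

Lemma sq_count_preds b c : size b = size c -> sq_count b c != 0%N -> b \in sq_preds c.
Proof.
elim: c b => [|y c IHc] [|x b] //.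
have -> : sq_preds (y :: c) =
    flatten [seq [seq x :: b | b <- sq_preds c] | x <- Nupto y & y \in sq_exps x] by [].
rewrite [sq_count _ _]/= => -[sbc].
case E: (count_mem y (sq_exps x)) => [|m] //.
rewrite muln_eq0 orFb => /(IHc _ sbc) bc.
have yx : y \in sq_exps x by rewrite -has_pred1 has_count E.
apply/flatten_mapP; exists x; last exact: map_f.
rewrite mem_filter yx; apply/mapP; exists (N.to_nat x); last by lia.
by rewrite mem_iota; have := sq_exps_ge yx; lia.
Qed.

Lemma dual_Ann cs : ann_check cs -> dual cs \in Ann 3 66.
Proof.
case/andP=> /allP hcs /allP hpred; apply/AnnP/annihilatedP => d k [p hp] /= dk k0.
rewrite -[LHS]/(eval (dual cs) (Sq k p)) eval_dual; last by rewrite -dk Sq_dhomog.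
move: p hp; apply: (@dhomog_ind _ _ (fun p => \sum_(c <- cs) (Sq k p)@_(mnm_of c) = 0)).
  by rewrite big1 // => c _; rewrite linear0 mcoeff0.
move=> r a q da IHq; under eq_bigr do rewrite linearP mcoeffD mcoeffZ /=.
rewrite big_split /= IHq addr0 -mulr_sumr.
suff -> : \sum_(c <- cs) (Sq k 'X_[a])@_(mnm_of c) = 0 :> F2 by rewrite mulr0.
rewrite -mon_expo_of; set b := expo_of a; have sb : size b = 4%N by apply: size_expo_of.
have nb : N.to_nat (Nsum b) = d by rewrite -mdeg_mnm_of // expo_ofK.
have cntE c : c \in cs -> (Sq k (mon vars b))@_(mnm_of c) = (sq_count b c)%:R.
  move=> /hcs /andP[/eqP sc /eqP nc].
  rewrite (@Sq_mon b k 66) //; last by rewrite nb dk.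
  rewrite linear_sum /= -(@count_sq_terms b c 66) ?sb ?sc // -sumn_count.
  rewrite -sum_natr big_seq [RHS]big_seq; apply: eq_bigr => e /size_sq_terms se.
  by rewrite mon_vars ?se // mcoeffX mnm_of_inj // se.
rewrite big_seq (eq_bigr _ cntE) -big_seq sum_natr natr_odd.
have [/hasP[c ccs cb]|/hasPn none] := boolP (has (fun c => sq_count b c != 0%N) cs).
  have := hpred b; rewrite (_ : Nsum b == 66%num = false) => [h|].
    rewrite (negPf (h _)) //; apply/flatten_mapP; exists c => //; apply: sq_count_preds cb.
    by rewrite sb; have /andP[/eqP->] := hcs _ ccs.
  by apply/eqP => nb66; move: nb; rewrite nb66; lia.
rewrite -natr_odd -sum_natr big_seq big1 // => c /none; rewrite negbK => /eqP->.
by [].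
Qed.

(** * The linear group on dual elements *)

Lemma rmorph_mon (f : {rmorphism P4 -> P4}) ys e : f (mon ys e) = mon [seq f y | y <- ys] e.
Proof.
elim: ys e => [|y ys IHys] [|a e] /=; rewrite ?rmorph1 //.
by rewrite rmorphM rmorphXn IHys.
Qed.

Definition col_vec (g : {'GL_4[F2]}) (i : 'I_4) : 'rV[F2]_4 := \row_j GLval g j i.

Lemma gl_act_mon g a : gl_act g (mon vars a) = mon [seq form (col_vec g i) | i <- enum 'I_4] a.
Proof.
rewrite rmorph_mon /vars -map_comp; congr mon; apply: eq_map => i /=.
by rewrite gl_actX /form; apply: eq_bigr => j _; rewrite mxE.
Qed.

Lemma eval_gl_dual (g : {'GL_4[F2]}) cs cols a :
    size cols = 4%N -> all (fun c => size c == 4%N) cs ->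
    a \in expos 4 66 ->
    (forall c (i j : 'I_4), c \in cs -> nth 0%num c j != 0%num ->
      GLval g^-1%g j i = (nth false (nth [::] cols i) j)%:R) ->
  eval (gl_dual g (dual cs)) (mon vars a) = (dual_coef cs cols a)%:R.
Proof.
move=> scols scs ha hcols; rewrite /eval gl_dualE /= pihomog_dE ?mon_homog //.
rewrite -/(eval _ _) eval_dual; last exact/gl_act_dhomog/mon_homog.
move: (ha); rewrite mem_expos => /andP[/eqP sa /eqP na].
(* Exponents are at most 66, so seven halvings, the fuel in [dual_coef], exhaust them. *)
have a_lt : all (fun x => N.ltb x (2 ^ N.of_nat 7)) a.
  by case: a sa na {ha} => [|x [|y [|z [|t []]]]] //= _; lia.
pose z := [seq (nth [::] cols i, col_vec g^-1%g i) | i : 'I_4 <- enum 'I_4].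
have zcols : unzip1 z = cols.
  rewrite /unzip1 -map_comp; apply: (@eq_from_nth _ [::]); rewrite size_map size_enum_ord //.
  by move=> i i4; rewrite (nth_map ord0) ?size_enum_ord //= nth_enum_ord.
elim: cs scs hcols => [|c cs IHcs]; first by rewrite big_nil.
rewrite -[dual_coef (c :: cs) _ _]/(coef 7 cols a c (+) dual_coef cs cols a).
case/andP=> /eqP sc scs hcols; rewrite big_cons natr_addb IHcs //; last first.
  by move=> d i j dcs; apply: hcols; rewrite inE dcs orbT.
have zform : [seq form x.2 | x <- z] = [seq form (col_vec g^-1%g i) | i <- enum 'I_4].
  by rewrite /z -map_comp.
congr (_ + _); rewrite gl_act_mon -zform -zcols.
have sz : size z = 4%N by rewrite size_map size_enum_ord.
apply: (coefE sz sa sc a_lt) => x j /mapP[i _ ->] cj /=; rewrite mxE;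
  exact: hcols (mem_head _ _) cj.
Qed.

Lemma unit_codeP h : unit_code h ->
  exists g : {'GL_4[F2]}, forall i j : 'I_4,
    GLval g^-1%g j i = (nth false (nth [::] (columns h) i) j)%:R.
Proof.
move=> /allP hu; pose M : 'M[F2]_4 := \matrix_(j, i) (N.testbit h (N.of_nat (4 * j + i)))%:R.
have i4 (i : 'I_4) : (i : nat) \in iota 0 4 by rewrite mem_iota ltn_ord.
have Mu : M \in unitmx.
  rewrite -row_full_unit -sub1mx; apply/row_subP => i.
  have /hasP[x _ /allP hx] := hu i (i4 i).
  apply/submxP; exists (\row_j (N.testbit x (N.of_nat j))%:R).
  apply/rowP => k; rewrite !mxE.
  have := hx k (i4 k); rewrite -sumn_count => /eqP hik.
  rewrite -[i == k]/(i == k :> nat) -hik -natr_odd -sum_natr.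
  rewrite -[iota 0 4]/(index_iota 0 4) big_mkord; apply: eq_bigr => j _.
  by rewrite !mxE -natrM mulnb.
(* A code describes g^-1, so the group element is the inverse of [M]. *)
exists ((FinRing.Unit Mu : {'GL_4[F2]})^-1)%g => i j.
rewrite invgK /= mxE (nth_map 0%N) ?size_iota // nth_iota // (nth_map 0%N) ?size_iota //.
by rewrite nth_iota.
Qed.

Lemma move_valP x : x \in moves -> exists g : {'GL_4[F2]},
  {in expos 4 66, forall a,
    eval (gl_dual g (dual x.1) - dual x.1) (mon vars a) = (move_val x a)%:R}.
Proof.
move=> hx; have [g hg] := unit_codeP (allP moves_unit _ hx).
have sx : all (fun c => size c == 4%N) x.1.
  have: all (fun x : seq (seq N) * N => all (fun c => size c == 4%N) x.1) moves.
    by vm_compute.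
  by move/allP/(_ _ hx).
exists g => a ha; rewrite {1}/eval add_lfunE opp_lfunE.
rewrite -![_ (homog_part 66 _)]/(eval _ _) (eval_dual_mon sx ha).
rewrite (@eval_gl_dual _ _ (columns x.2)) ?size_map //.
rewrite natr_addb; congr (_ + _); apply/eqP; rewrite eq_sym -addr_eq0; apply/eqP/addF2.
Qed.

(** * A spanning set of the annihilator *)

Lemma vec_val_row_vec (Phi : nat -> F2) r :
  vec_val (fun p => Phi (Pos.to_nat p).-1) (row_vec r) =
  \sum_(k <- iota 0 (size basis66)) (r (nth [::] basis66 k))%:R * Phi k.
Proof.
rewrite /row_vec; elim: (iota 0 _) => [|k s IHs]; first by rewrite /vec_val !big_nil.
rewrite big_cons -[foldr _ _ _]/(row_step r k (foldr (row_step r) [::] s)) {1}/row_step.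
case: ifP => _; last by rewrite IHs mul0r add0r.
rewrite vec_val_add IHs mul1r; congr (_ + _); rewrite /vec_val big_seq1.
by congr Phi; rewrite Pnat.SuccNat2Pos.id_succ.
Qed.

(** The dual form of the rank check: a linear functional on the coordinate space, given by its
    values [Phi k] on unit vectors, is zero once it kills every row. *)
Lemma rank_eq0 (Phi : nat -> F2) :
    \sum_(k <- iota 0 (size basis66))
      (odd (count_mem (nth [::] basis66 k) flag_dual))%:R * Phi k = 0 ->
    (forall x, x \in moves ->
      \sum_(k <- iota 0 (size basis66)) (move_val x (nth [::] basis66 k))%:R * Phi k = 0) ->
  forall k, (k < size basis66)%N -> Phi k = 0.
Proof.
move=> flag0 moves0 k kN; pose phi p := Phi (Pos.to_nat p).-1.
have := rank_checkT; rewrite /rank_check.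
have st : sound phi (insert (PositiveMap.empty _)
    (row_vec (fun a => odd (count_mem a flag_dual)))).
  by apply: sound_insert; [exact: sound_empty | rewrite vec_val_row_vec].
move: (insert _ _) st => t st; cbv zeta.
set t' := foldl _ _ _; have st' : sound phi t'.
  apply: sound_foldl st => u x xm su; apply: (sound_insert su).
  by rewrite vec_val_row_vec moves0.
move/allP/(_ k); rewrite mem_iota => /(_ kN)/(nilp_normal_form st').
by rewrite /vec_val big_seq1 /phi Pnat.SuccNat2Pos.id_succ.
Qed.

Lemma basis66_expos : {subset basis66 <= expos 4 66}.
Proof.
have: all (fun e => (size e == 4%N) && (Nsum e == 66%num)) basis66 by vm_compute.
by move/allP=> h e /h; rewrite mem_expos.
Qed.

Definition move_at (r : 'I_(size moves)) := nth ([::], 0%num) moves r.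

Lemma flag_Ann : dual flag_dual \in Ann 3 66.
Proof. by apply: dual_Ann; move/allP: ann_checkT; apply; rewrite !inE eqxx. Qed.

Lemma moves_Ann x : x \in moves -> dual x.1 \in Ann 3 66.
Proof.
move=> xm; apply: dual_Ann; move/allP: ann_checkT; apply.
by move: xm; rewrite !mem_cat => /or3P[] /mapP[h _ ->]; rewrite !inE eqxx ?orbT.
Qed.

(** The coordinates of [f] on [basis66] are a combination of the rows. The same combination of the
    elements themselves differs from [f] by an annihilated element that vanishes on [basis66], hence
    by 0. *)
Lemma Ann_span : exists g : 'I_(size moves) -> {'GL_4[F2]},
  forall f, f \in Ann 3 66 -> exists (c0 : F2) (c : 'I_(size moves) -> F2),
    f = c0 *: dual flag_dual +
      \sum_r c r *: (gl_dual (g r) (dual (move_at r).1) - dual (move_at r).1).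
Proof.
have in_moves r : move_at r \in moves by apply: mem_nth.
have [g hg] := fin_all_exists (fun r => move_valP (in_moves r)).
exists g => f fA; pose n := size basis66; pose b (k : nat) := nth [::] basis66 k.
have hb k : (k < n)%N -> b k \in expos 4 66 by move=> kn; apply/basis66_expos/mem_nth.
pose M0 : 'M[F2]_(1, n) := \row_k (odd (count_mem (b k) flag_dual))%:R.
pose M1 : 'M[F2]_(_, n) := \matrix_(r, k) (move_val (move_at r) (b k))%:R.
pose u : 'rV[F2]_n := \row_k eval f (mon vars (b k)).
have /submxP[D uE] : (u <= col_mx M0 M1)%MS.
  (* Each column of the cokernel kills all rows, so [rank_eq0] applies to it. *)
  rewrite submxE; suff -> : cokermx (col_mx M0 M1) = 0 by rewrite mulmx0.
  move: (cokermx _) (mulmx_coker (col_mx M0 M1)) => C /eqP.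
  rewrite mul_col_mx col_mx_eq0 => /andP[/eqP/matrixP C0 /eqP/matrixP C1].
  apply/matrixP => k j; rewrite mxE.
  pose Phi i := if insub i is Some i' then C i' j else 0.
  have PhiE (i : 'I_n) : Phi i = C i j by rewrite /Phi valK.
  rewrite -PhiE; apply: rank_eq0 (ltn_ord k) => [|x xm].
    transitivity ((M0 *m C) 0 j); last by rewrite C0 mxE.
    rewrite mxE -[iota 0 _]/(index_iota 0 n) big_mkord; apply: eq_bigr => i _.
    by rewrite PhiE mxE.
  have xi : (index x moves < size moves)%N by rewrite index_mem.
  transitivity ((M1 *m C) (Ordinal xi) j); last by rewrite C1 mxE.
  rewrite mxE -[iota 0 _]/(index_iota 0 n) big_mkord; apply: eq_bigr => i _.
  by rewrite PhiE mxE /move_at nth_index.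
exists (lsubmx D 0 0), (fun r => rsubmx D 0 r).
set F := _ + _; apply/eqP; rewrite -subr_eq0; apply/eqP; apply: eval_eq0.
have wA r : gl_dual (g r) (dual (move_at r).1) - dual (move_at r).1 \in Ann 3 66.
  have dA : dual (move_at r).1 \in Ann 3 66 by apply: moves_Ann.
  by rewrite rpredB // Ann_gl.
have FA : F \in Ann 3 66.
  rewrite rpredD ?rpredZ ?flag_Ann // rpred_sum // => r _; exact: rpredZ.
apply: (killing66_eq0 (killing_Ann (rpredB fA FA))) => e /(nthP [::])[k kn <-].
pose k' : 'I_n := Ordinal kn; have ha := hb k kn.
rewrite /eval add_lfunE opp_lfunE; apply/eqP; rewrite subr_eq0; apply/eqP.
transitivity (u 0 k'); first by rewrite mxE.
rewrite uE -[D in LHS]hsubmxK mul_row_col mxE /F add_lfunE scale_lfunE [X in _ = _ + X]sum_lfunE.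
congr (_ + _).
  rewrite mxE big_ord_recl big_ord0 addr0; congr (_ * _).
  rewrite mxE -[RHS]/(eval (dual flag_dual) (mon vars (b k))) eval_dual_mon //.
rewrite mxE; apply: eq_bigr => r _; rewrite scale_lfunE; congr (_ * _).
by rewrite mxE -hg.
Qed.

(** * The invariant functional *)

Lemma foldr_addb_has (T : Type) (p : T -> bool) s :
  foldr (fun x b => p x (+) b) false s -> has p s.
Proof. by elim: s => //= x s IHs; case: (p x). Qed.

(** A nonzero coefficient requires at least one choice of a variable from each form; [c'] is what
    remains of [c] after that choice. *)
Lemma pick_coef_true cols (cont : seq N -> bool) c : size c = 4%N -> pick_coef cols cont c ->
  exists c', [/\ cont c', size c' = 4%N, forall j, (nth 0%num c' j <= nth 0%num c j)%num
    & Nsum c = N.add (Nsum c') (N.of_nat (size cols))].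
Proof.
elim: cols c => [|col cols IHcols] c sc; first by exists c; split=> //= [j|]; lia.
rewrite -[pick_coef _ _ _]/(foldr (fun c' b =>
  pick_coef cols cont c' (+) b) false (branches col c)).
case/foldr_addb_has/hasP=> c' c'b E; have /mapP[j] := c'b.
rewrite mem_filter mem_iota => /andP[/andP[_ cj] /= j4] c'E.
have sc' : size c' = 4%N by rewrite c'E size_set_nth sc; lia.
have [d [cd sd led sumd]] := IHcols _ sc' E.
exists d; split=> // [i|].
  apply: N.le_trans (led i) _; rewrite c'E nth_set_nth /=; case: (eqVneq i j) => [->|_]; lia.
suff: Nsum c = N.succ (Nsum c') by lia.
rewrite c'E; move: sc cj j4; clear.
by case: c => [|x [|y [|z [|t []]]]] // _; case: j => [|[|[|[|]]]] //= cj _; lia.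
Qed.

Lemma coef_true fuel cols a c : size c = 4%N -> size cols = size a -> coef fuel.+1 cols a c ->
  exists c', [/\ all (fun x => ~~ N.odd x) c',
    coef fuel cols [seq N.div2 x | x <- a] [seq N.div2 x | x <- c'], size c' = 4%N,
    forall j, (nth 0%num c' j <= nth 0%num c j)%num
  & Nsum c = N.add (Nsum c') (N.of_nat (count N.odd a))].
Proof.
move=> sc sa; rewrite [coef _ _ _ _]/(pick_coef _ _ _) => /(pick_coef_true sc)[c' []].
case: ifP => // /negbT; rewrite -all_predC => ev cc' sc' le sum; exists c'; split=> //.
by rewrite sum size_mask ?size_map // count_map.
Qed.

Definition all_odd_spiky (c : seq N) :=
    all N.odd c && (2 < count N.odd [seq N.div2 x | x <- c])%N.

(** The two parity types among the coordinates of [lambda], with too few odd digits to reach an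
    [all_odd_spiky] exponent. *)
Definition light (a : seq N) :=
  (count N.odd a == 2%N) || (count N.odd a == 4%N) && (count N.odd [seq N.div2 x | x <- a] == 1%N).

(** An even number below an odd one is smaller by at least 1. If the total drop is no larger than
    that, odd entries drop by exactly 1 and even ones stay, which preserves halves. *)
Lemma even_below (c c' : seq N) : size c = 4%N -> size c' = 4%N ->
    all (fun x => ~~ N.odd x) c' -> (forall j, (nth 0%num c' j <= nth 0%num c j)%num) ->
  [/\ (Nsum c' + N.of_nat (count N.odd c) <= Nsum c)%num
    & Nsum c = (Nsum c' + N.of_nat (count N.odd c))%num ->
      [seq N.div2 x | x <- c'] = [seq N.div2 x | x <- c]].
Proof.
case: c c' => [|x [|y [|z [|t []]]]] // [|x' [|y' [|z' [|t' []]]]] //= _ _.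
move=> /and5P[x0 y0 z0 t0 _] le; have := (le 0, le 1, le 2, le 3)%N.
have half u u' : ~~ N.odd u' -> (u' <= u)%num -> (u' + N.of_nat (N.odd u) <= u)%num /\
    (u = u' + N.of_nat (N.odd u) -> N.div2 u' = N.div2 u)%num.
  move=> u'0 u'u.
  have uE v : v = (N.div2 v + N.div2 v + N.of_nat (N.odd v))%num.
    by case: v => [|[q|q|]] //=; lia.
  move: (uE u) (uE u'); rewrite (negPf u'0).
  by case: (N.odd u) => /=; lia.
case=> [[[/half-/(_ x0)[hx ex] /half-/(_ y0)[hy ey]] /half-/(_ z0)[hz ez]] /half-/(_ t0)[ht et]].
rewrite /= in hx ex hy ey hz ez ht et.
rewrite !Nnat.Nat2N.inj_add; clear half le x0 y0 z0 t0.
move: hx ex hy ey hz ez ht et; move: (N.of_nat (N.odd x)) (N.of_nat (N.odd y)).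
move: (N.of_nat (N.odd z)) (N.of_nat (N.odd t)) => p q r s hx ex hy ey hz ez ht et.
split=> [|e]; first by clear ex ey ez et; lia.
have [e1 e2 e3 e4] : [/\ x = x' + r, y = y' + s, z = z' + p & t = t' + q]%num.
  by clear ex ey ez et; split; lia.
by rewrite ex // ey // ez // et.
Qed.

(* A monomial in the product has to be even once one factor is removed for each
   odd a_i: four odd exponents of c need four odd a_i, and likewise for the
   halves. *)
Lemma coef_spiky fuel cols a c : size c = 4%N -> size cols = 4%N -> size a = 4%N ->
  light a -> all_odd_spiky c -> coef fuel.+2 cols a c = false.
Proof.
move=> sc scols sa la /andP[oc sp]; apply/negP => cT.
have [|c' [ev cc' sc' le sum]] := coef_true sc _ cT; first by rewrite scols sa.
have co : count N.odd c = 4%N by rewrite -sc; apply/eqP; rewrite -all_count.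
have [le_c eq_c] := even_below sc sc' ev le.
case/orP: la => [/eqP a2|/andP[/eqP a4 /eqP a1]]; first by lia.
have [||d [evd _ sd led]] := coef_true _ _ cc'; rewrite ?size_map ?scols ?sa // a1.
have [] := even_below _ sd evd led; rewrite ?size_map // eq_c; last by lia.
by move: sp; lia.
Qed.

Definition lambda (f : H66) : F2^o := \sum_(a <- invariant_expos) eval f (mon vars a).

Lemma lambda_is_linear : linear lambda.
Proof.
move=> c f g; rewrite /lambda scaler_sumr -big_split; apply: eq_bigr => a _.
by rewrite /eval add_lfunE scale_lfunE.
Qed.

HB.instance Definition _ := GRing.isLinear.Build F2 H66 F2^o _ lambda lambda_is_linear.

Lemma invariant_exposP a : a \in invariant_expos -> a \in expos 4 66 /\ light a.
Proof.
have: all (fun a => ((size a == 4%N) && (Nsum a == 66%num)) && light a) invariant_expos.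
  by vm_compute.
by move/allP=> h /h; rewrite mem_expos => /andP[].
Qed.

Definition bit_row (g : {'GL_4[F2]}) (j : 'I_4) : bitseq :=
    [seq GLval g j i != 0 | i <- enum 'I_4].

Lemma size_bit_row g j : size (bit_row g j) = 4%N.
Proof. by rewrite size_map size_enum_ord. Qed.

Lemma nth_bit_row g j (i : 'I_4) : (nth false (bit_row g j) i)%:R = GLval g j i.
Proof.
rewrite (nth_map ord0) ?size_enum_ord // nth_ord_enum.
by case: (F2_cases (GLval g j i)) => ->; rewrite ?eqxx ?oner_eq0.
Qed.

Lemma bit_row_inj g : injective (bit_row g).
Proof.
move=> j k e; apply/eqP; apply: contraT => ne.
have jk : row j (GLval g) = row k (GLval g).
  by apply/rowP => i; rewrite !mxE -!nth_bit_row e.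
have gfree : row_free (GLval g) by rewrite row_free_unit GL_unit.
have /(row_free_inj gfree)/rowP/(_ j) : delta_mx 0 j *m GLval g = delta_mx (0 : 'I_1) k *m GLval g.
  by rewrite -!rowE.
by rewrite !mxE !eqxx (negPf ne) => /eqP; rewrite oner_eq0.
Qed.

Lemma bit_row_nonzero g j : bit_row g j \in nonzero_rows.
Proof.
have -> : nonzero_rows = [seq v <- bitseqs 4 | has id v] by [].
rewrite mem_filter; apply/andP; split.
  apply: contraT => /hasPn none.
  have j0 : row j (GLval g) = 0.
    apply/rowP => i; rewrite !mxE -nth_bit_row.
    have : nth false (bit_row g j) i \in bit_row g j.
      by apply: mem_nth; rewrite size_map size_enum_ord.
    by move/none/negPf->.
  have gfree : row_free (GLval g) by rewrite row_free_unit GL_unit.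
  have /(row_free_inj gfree)/rowP/(_ j) : delta_mx (0 : 'I_1) j *m GLval g = 0 *m GLval g.
    by rewrite -rowE j0 mul0mx.
  by rewrite !mxE !eqxx => /eqP; rewrite oner_eq0.
have: size (bit_row g j) = 4%N by rewrite size_map size_enum_ord.
by case: (bit_row g j) => [|[] [|[] [|[] [|[] []]]]].
Qed.

Lemma sum_natr_addb (T : Type) (s : seq T) (p : T -> bool) :
  \sum_(x <- s) (p x)%:R = (foldr (fun x b => p x (+) b) false s)%:R :> F2.
Proof. by elim: s => [|x s IHs]; rewrite ?big_nil // big_cons IHs -natr_addb. Qed.

(** Only rows 0 and 1 of g^-1 enter; they are nonzero and distinct, hence covered by
    [flag_check]. *)
Lemma lambda_flag (g : {'GL_4[F2]}) : lambda (gl_dual g (dual flag_dual)) = 1.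
Proof.
pose v := bit_row g^-1%g 0; pose w := bit_row g^-1%g (lift 0 0).
transitivity (\sum_(a <- invariant_expos) (dual_coef flag_dual (flag_columns v w) a)%:R : F2).
  rewrite /lambda big_seq [RHS]big_seq; apply: eq_bigr => a /invariant_exposP[ha _].
  apply: eval_gl_dual => //; first by rewrite size_map size_zip !size_bit_row.
  move=> c i j; rewrite inE => /eqP-> cj.
  rewrite (nth_map (false, false)); last by rewrite size_zip !size_bit_row.
  rewrite nth_zip; last by rewrite !size_bit_row.
  case: j cj => [[|[|[|[|j]]]] j4] //= _; rewrite nth_bit_row.
    by rewrite (_ : Ordinal j4 = 0) //; apply: val_inj.
  by rewrite (_ : Ordinal j4 = lift 0 0) //; apply: val_inj.
rewrite sum_natr_addb.
have /allP/(_ _ (bit_row_nonzero g^-1%g 0))/allP/(_ _ (bit_row_nonzero g^-1%g (lift 0 0))) :=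
    flag_checkT.
by rewrite (inj_eq (@bit_row_inj _)) orFb => ->.
Qed.

Lemma lambda_spiky (g : {'GL_4[F2]}) cs : all (fun c => (size c == 4%N) && all_odd_spiky c) cs ->
  lambda (gl_dual g (dual cs)) = 0.
Proof.
move=> hcs; rewrite /lambda big_seq big1 // => a /invariant_exposP[ha la].
have scs : all (fun c => size c == 4%N) cs by apply: sub_all hcs => c /andP[].
pose cols := [seq [seq GLval g^-1%g j i != 0 | j <- enum 'I_4] | i <- enum 'I_4].
have scols : size cols = 4%N by rewrite size_map size_enum_ord.
have sa : size a = 4%N by move: ha; rewrite mem_expos => /andP[/eqP].
rewrite (@eval_gl_dual _ _ cols) // => [|c i j _ _]; last first.
  rewrite (nth_map ord0) ?size_enum_ord // nth_ord_enum.
  rewrite (nth_map ord0) ?size_enum_ord // nth_ord_enum.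
  by case: (F2_cases (GLval g^-1%g j i)) => ->; rewrite ?eqxx ?oner_eq0.
rewrite /dual_coef -sum_natr_addb big_seq big1 // => c /(allP hcs)/andP[/eqP sc oc].
by rewrite coef_spiky.
Qed.

(** * Invariance and the coinvariants *)

Lemma gl_dual1 (f : H66) : gl_dual 1%g f = f.
Proof. by apply/lfunP => p; rewrite gl_dualE invg1 gl_act1 homog_part_id. Qed.

Lemma gl_dualM (g g' : {'GL_4[F2]}) (f : H66) : gl_dual g (gl_dual g' f) = gl_dual (g * g')%g f.
Proof.
apply/lfunP => p; rewrite [RHS]gl_dualE invMg gl_actM !gl_dualE.
have hp : gl_act g^-1%g (val p) \is 66.-homog.
  exact: (gl_act_dhomog g^-1%g (dhomog_is_dhomog p)).
by rewrite [val (homog_part _ _)](pihomog_dE hp).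
Qed.

Lemma moves_dual x : x \in moves ->
  x.1 = flag_dual \/ all (fun c => (size c == 4%N) && all_odd_spiky c) x.1.
Proof.
rewrite !mem_cat => /or3P[] /mapP[h _ ->]; [by left | right | right].
  by vm_compute.
by vm_compute.
Qed.

Lemma lambda_moves x (g g' : {'GL_4[F2]}) : x \in moves ->
  lambda (gl_dual g (dual x.1)) = lambda (gl_dual g' (dual x.1)).
Proof.
case/moves_dual => [->|sx].
  by transitivity (1 : F2^o); [|symmetry]; exact: lambda_flag.
by transitivity (0 : F2^o); [|symmetry]; exact: lambda_spiky.
Qed.

Lemma lambda_sub0 f f' : lambda f = lambda f' -> lambda (f - f') = 0.
Proof. by move=> e; rewrite linearB /= e subrr. Qed.

(** On each of the three elements in the spanning set, [lambda] is constant along the orbit.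
    Translating the expansion of [f] by any k therefore kills the differences and leaves the
    coefficient [c0] of e, which does not depend on k. *)
Lemma lambda_gl (g : {'GL_4[F2]}) f : f \in Ann 3 66 -> lambda (gl_dual g f) = lambda f.
Proof.
move=> fA; have [h /(_ f fA)[c0 [c fE]]] := Ann_span.
have key k : lambda (gl_dual k f) = c0.
  have -> : gl_dual k f = c0 *: gl_dual k (dual flag_dual) + \sum_r c r *:
      (gl_dual (k * h r)%g (dual (move_at r).1) - gl_dual k (dual (move_at r).1)).
    rewrite {1}fE linearD linearZ [X in _ + X = _]linear_sum; congr (_ + _).
    by apply: eq_bigr => r _; rewrite linearZ linearB /= gl_dualM.
  rewrite linearD linearZ [X in _ + X = _]linear_sum big1 => [|r _].
    by rewrite addr0 -[RHS]mulr1; congr (_ * _); apply: lambda_flag.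
  rewrite linearZ; transitivity (c r *: (0 : F2^o)); last exact: scaler0.
  by congr (_ *: _); apply: lambda_sub0; apply: lambda_moves; apply: mem_nth.
by rewrite -{2}[f]gl_dual1; transitivity c0; [|symmetry]; exact: key.
Qed.

Lemma lambda_coinv_rel z : z \in coinv_rel 3 66 -> lambda (val z) = 0.
Proof.
case/memv_sumP => y hy ->; rewrite !linear_sum big1 //= => g _.
have /memv_imgP[w _ ->] := hy g isT.
rewrite add_lfunE opp_lfunE id_lfunE lfunE /=.
by apply: lambda_sub0; apply: lambda_gl; apply: subvsP.
Qed.

Lemma mem_coinv_rel (g : {'GL_4[F2]}) (z : subvs_of (Ann 3 66)) :
  Ann_act g z - z \in coinv_rel 3 66.
Proof.
rewrite /coinv_rel (bigD1 g) //=; apply: subvP (addvSl _ _) _ _.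
apply/memv_imgP; exists z; first exact: memvf.
by rewrite add_lfunE opp_lfunE id_lfunE lfunE.
Qed.

Local Notation cls z := (vquot_pi (coinv_rel 3 66) z).

Lemma coinv_flag (z : subvs_of (Ann 3 66)) :
  exists c : F2, cls z = c *: cls (Subvs flag_Ann).
Proof.
have [g hg] := Ann_span; have [c0 [c zE]] := hg _ (subvsP z); exists c0.
have in_moves r : move_at r \in moves by apply: mem_nth.
pose y r : subvs_of (Ann 3 66) := Subvs (moves_Ann (in_moves r)).
have -> : z = c0 *: Subvs flag_Ann + \sum_r c r *: (Ann_act (g r) (y r) - y r).
  apply: val_inj; rewrite -![val]/(@vsval _ _ (Ann 3 66)) zE linearD linearZ.
  by rewrite [X in _ = _ + X]linear_sum; congr (_ + _).
rewrite -linearZ; apply/vquot_piP; rewrite addrC addKr.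
by apply: memv_suml => r _; apply: memvZ; apply: mem_coinv_rel.
Qed.

Theorem theorem2p2p3 :
  let n'2 : nat := (17 * 2 ^ 2 - 2)%N in
  let zeta : homology 3 n'2 := dual_monomial n'2 [multinom [tuple 1; 1; 1; 63]%N] in
  exists zeta_Ann : zeta \in Ann 3 n'2,
    \dim {: coinvariants 3 n'2} = 1%N /\
    basis_of {: coinvariants 3 n'2}%VS [:: coinv_class zeta_Ann].
Proof.
have -> : (17 * 2 ^ 2 - 2)%N = 66%N by [].
cbv zeta; set zeta : homology 3 66 := dual_monomial _ _.
have zetaE : zeta = dual [:: [:: 1; 1; 1; 63]%num].
  rewrite /dual big_seq1; congr dual_monomial; apply/mnmP => i; rewrite !mnmE.
  by case: i => [[|[|[|[|]]]] ?].
have zeta_Ann : zeta \in Ann 3 66.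
  by rewrite zetaE; apply: dual_Ann; move/allP: ann_checkT; apply; rewrite !inE eqxx !orbT.
exists zeta_Ann.
have lambda_zeta : lambda zeta = 1.
  rewrite /lambda zetaE; transitivity (\sum_(a <- invariant_expos)
      (odd (count_mem a [:: [:: 1; 1; 1; 63]%num]))%:R : F2).
    by rewrite big_seq [RHS]big_seq; apply: eq_bigr => a /invariant_exposP[ha _];
      apply: eval_dual_mon.
  have -> : 1 = true%:R :> F2 by [].
  by rewrite sum_natr natr_odd; apply: (congr1 (fun b : bool => b%:R)); vm_compute.
pose q := coinv_class zeta_Ann.
have q0 : q != 0.
  apply/eqP; rewrite -(linear0 (vquot_pi (coinv_rel 3 66))) => /vquot_piP; rewrite subr0.
  by move/lambda_coinv_rel/eqP; rewrite /= lambda_zeta oner_eq0.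
have [c qE] := coinv_flag (Subvs zeta_Ann).
have span_q : {: coinvariants 3 66}%VS = <[q]>%VS.
  apply/eqP; rewrite eqEsubv subvf andbT; apply/subvP => x _.
  have [z ->] : exists z, x = cls z by exists (generic_quotient.repr (x : vquot _));
    rewrite vquot_repr.
  have [d ->] := coinv_flag z; apply/vlineP; exists d; congr (_ *: _).
  (* Over F_2 a nonzero [c] is 1, so the class of zeta equals that of e, which spans. *)
  have : c != 0 by apply: contra_neq q0 => c0; rewrite /q /coinv_class qE c0 scale0r.
  by case: (F2_cases c) qE => -> // qE _; rewrite /q /coinv_class qE scale1r.
split; first by rewrite span_q dim_vline q0.
by rewrite basisEfree seq1_free q0 span_seq1 span_q subvv dim_vline q0.
Qed.
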